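(* Let $\pi$ be a Lebesgue probability density on $\mathbb{R}^k$ with $\nabla\log\pi$ Lipschitz continuous, and suppose that $\pi$ admits second moments. Let $\Gamma=\mathrm{Var}_{X\sim\pi}(X)$ and $\mathcal{F}=\{x\mapsto v'x:\ v\in\mathbb{R}^k\setminus\{0\}\}$. For symmetric positive definite $\Lambda\in\mathbb{R}^{k\times k}$, let $\mathbf{X}$ be the stationary diffusion with generator $G^\Lambda$ and $\mathbf{X}(0)\sim\pi$. Then $\Lambda=\Gamma$ maximises, over symmetric positive definite $\Lambda$, the worst case (over $f\in\mathcal{F}$) rate at which the autocorrelation of $f(\mathbf{X})$ decays in a neighbourhood of lag $0$; that is, $\Lambda=\Gamma$ maximises $$\inf_{f\in\mathcal{F}}\left|\frac{d}{dt}\mathrm{Corr}\big(f(\mathbf{X}(0)),f(\mathbf{X}(t))\big)\Big|_{t=0^+}\right|.$$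
   Context: The Lipschitz assumption is understood to include that $\log\pi$ is finite and differentiable on $\mathbb{R}^k$. Let $\Sigma=\mathrm{Var}_{X\sim\pi}(\nabla\log\pi(X))$ and $A:B=\sum_{i,j}A_{ji}B_{ij}$. $G^\Lambda$ is the generator (of a reversible diffusion with stationary density $\pi$, regarded in $L^2(\pi)$) $$G^{\Lambda}f=k\Big(\frac{\Lambda}{\Lambda:\Sigma}:\nabla^2f+[\nabla\log\pi]'\frac{\Lambda}{\Lambda:\Sigma}\nabla f\Big).$$ *)

(* Defs.v *)
From HB Require Import structures.
From mathcomp Require Import all_boot all_order all_algebra.
From mathcomp Require Import all_classical all_reals all_analysis.

Set Implicit Arguments.
Unset Strict Implicit.
Unset Printing Implicit Defensive.
Import Order.TTheory GRing.Theory Num.Theory.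
Import numFieldNormedType.Exports.

Local Open Scope classical_set_scope.
Local Open Scope ring_scope.

(* Points of R^k are row vectors: the transposes in products such as v'x are
   therefore swapped with respect to the column convention. *)

(* The sigma-algebra on matrices generated by the entries (as the library does
   for tuples); on 'rV[R]_k it is the Borel sigma-algebra of R^k. *)
Definition measure_matrix_display : measure_display -> measure_display.
Proof. exact. Qed.

Section measurable_matrix.
Context {d} {T : measurableType d}.
Variables m n : nat.

Definition mx_cylinders : set (set 'M[T]_(m, n)) :=
  \bigcup_ij preimage_set_system setT
    (fun M : 'M[T]_(m, n) => M ij.1 ij.2) measurable.

Let mx_set0 : <<s mx_cylinders >> set0.
Proof. exact: sigma_algebra0. Qed.

Let mx_setC A : <<s mx_cylinders >> A -> <<s mx_cylinders >> (~` A).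
Proof. exact: sigma_algebraC. Qed.

Let mx_bigcup (F : _^nat) : (forall i, <<s mx_cylinders >> (F i)) ->
  <<s mx_cylinders >> (\bigcup_i (F i)).
Proof. exact: sigma_algebra_bigcup. Qed.

HB.instance Definition _ := @isMeasurable.Build (measure_matrix_display d)
  'M[T]_(m, n) <<s mx_cylinders >> mx_set0 mx_setC mx_bigcup.

Lemma measurable_coord i j : measurable_fun setT (fun M : 'M[T]_(m, n) => M i j).
Proof.
move=> _ Y mY; apply: sub_sigma_algebra; exists (i, j) => //.
by exists Y.
Qed.

Lemma measurable_fun_mxP d' (S : measurableType d') (f : S -> 'M[T]_(m, n)) :
  measurable_fun setT f <-> forall i j, measurable_fun setT (fun x => f x i j).
Proof.
split=> [mf i j|mf].
  exact: (measurableT_comp (measurable_coord i j) mf).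
apply: (@measurability _ _ _ _ setT f mx_cylinders) => //.
by move=> _ [_ [[i j] _ [Y mY <-]]] <-; rewrite !setTI; rewrite -[X in measurable X]setTI; exact: mf.
Qed.

End measurable_matrix.

Lemma sigma_finite_product d1 d2 (T1 : measurableType d1)
    (T2 : measurableType d2) (R : realType)
    (m1 : {sigma_finite_measure set T1 -> \bar R})
    (m2 : {sigma_finite_measure set T2 -> \bar R}) :
  sigma_finite setT (m1 \x m2)%E.
Proof.
have /sigma_finiteP[F [TF ndF Foo]] := sigma_finiteT m1.
have /sigma_finiteP[G [TG ndG Goo]] := sigma_finiteT m2.
exists (fun n => F n `*` G n).
  rewrite -setXTT TF TG predeqE => -[x y]; split.
    move=> [/= [n _ Fnx] [k _ Gky]]; exists (maxn n k) => //; split.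
    - by move: x Fnx; exact/subsetPset/ndF/leq_maxl.
    - by move: y Gky; exact/subsetPset/ndG/leq_maxr.
  by move=> [n _ []/= ? ?]; split; exists n.
move=> k; have [? ?] := Foo k; have [? ?] := Goo k.
split; first exact: measurableX.
by rewrite product_measure1E// lte_mul_pinfty// ge0_fin_numE.
Qed.

Section lebesgue_step.
Context {R : realType} (n : nat).
Variable m : {sigma_finite_measure set 'rV[R]_n -> \bar R}.

Definition row_cons (x : R * 'rV[R]_n) : 'rV[R]_n.+1 := row_mx x.1%:M x.2.

Definition row_uncons (x : 'rV[R]_n.+1) : R * 'rV[R]_n :=
  (x 0 0, rsubmx (x : 'rV[R]_(1 + n))).

Lemma row_consK : cancel row_cons row_uncons.
Proof.
move=> [a v]; rewrite /row_uncons /row_cons /= row_mxKr; congr pair.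
have E : (0 : 'I_n.+1) = lshift n (0 : 'I_1) by exact/val_inj.
by rewrite E (@row_mxEl _ 1 1 n) mxE eqxx mulr1n.
Qed.

Lemma measurable_row_cons : measurable_fun setT row_cons.
Proof.
apply/measurable_fun_mxP => i j.
case: (split_ordP (j : 'I_(1 + n))) => l ->; rewrite /row_cons.
- rewrite (_ : (fun _ => _) = fst); first exact: measurable_fst.
  by apply/funext => x; rewrite (@row_mxEl _ 1 1 n) mxE (ord1 i) (ord1 l) eqxx mulr1n.
- rewrite (_ : (fun _ => _) = (fun M : 'rV[R]_n => M i l) \o snd).
    by apply: measurableT_comp; [exact: measurable_coord|exact: measurable_snd].
  by apply/funext => x; rewrite (@row_mxEr _ 1 1 n).
Qed.

Lemma measurable_row_uncons : measurable_fun setT row_uncons.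
Proof.
apply/measurable_fun_pairP; split; first exact: measurable_coord.
apply/measurable_fun_mxP => i j.
rewrite (_ : (fun _ => _) =
  fun M : 'rV[R]_n.+1 => M i (rshift 1 j)); first exact: measurable_coord.
by apply/funext => x; rewrite /row_uncons /= mxE.
Qed.

Definition lebesgue_step : set 'rV[R]_n.+1 -> \bar R :=
  pushforward (lebesgue_measure \x m)%E row_cons.

Let step0 : lebesgue_step set0 = 0%E.
Proof. by rewrite /lebesgue_step /pushforward preimage_set0 measure0. Qed.

Let step_ge0 A : (0 <= lebesgue_step A)%E.
Proof. rewrite /lebesgue_step /pushforward; exact: measure_ge0. Qed.

Let step_sigma_additive : semi_sigma_additive lebesgue_step.
Proof.
move=> F mF tF mUF; rewrite /lebesgue_step /pushforward preimage_bigcup.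
have mpre A : measurable A -> measurable (row_cons @^-1` A).
  by move=> mA; rewrite -[X in measurable X]setTI; exact: measurable_row_cons.
apply: measure_semi_sigma_additive.
- by move=> i; exact: mpre.
- apply/trivIsetP => /= i j _ _ ij; rewrite -preimage_setI.
  by move/trivIsetP : tF => /(_ _ _ _ _ ij) ->//; rewrite preimage_set0.
- by rewrite -preimage_bigcup; exact: mpre.
Qed.

HB.instance Definition _ := isMeasure.Build _ _ _ lebesgue_step
  step0 step_ge0 step_sigma_additive.

Let step_sigma_finite : sigma_finite setT lebesgue_step.
Proof.
have [F UF mF] := sigma_finite_product lebesgue_measure m.
exists (fun i => row_uncons @^-1` F i).
  by rewrite -preimage_bigcup -UF preimage_setT.
move=> i; have [mFi Fioo] := mF i; split.
  by rewrite -[X in measurable X]setTI; exact: measurable_row_uncons.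
rewrite /lebesgue_step /pushforward -comp_preimage.
by rewrite (_ : row_uncons \o row_cons = id)//; apply/funext => x; exact: row_consK.
Qed.

HB.instance Definition _ := Measure_isSigmaFinite.Build _ _ _ lebesgue_step
  step_sigma_finite.

End lebesgue_step.

(* lambda on R^n.+1 is the image of lambda \x lambda^n under row_cons. *)
Fixpoint lebesgue_rV {R : realType} (n : nat) :
    {sigma_finite_measure set 'rV[R]_n -> \bar R} :=
  match n with
  | 0 => [the {sigma_finite_measure set 'rV[R]_0 -> \bar R} of \d_(0 : 'rV[R]_0)]
  | n'.+1 => [the {sigma_finite_measure set 'rV[R]_n'.+1 -> \bar R} of
              lebesgue_step (lebesgue_rV n')]
  end.

Section calculus.
Context {R : realType} {k : nat}.
Implicit Types (f : 'rV[R]_k -> R) (x : 'rV[R]_k).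

Definition partial (i : 'I_k) f : 'rV[R]_k -> R := 'D_(delta_mx 0 i) f.

Definition gradient f x : 'rV[R]_k := \row_i partial i f x.

Definition hessian f x : 'M[R]_k := \matrix_(i, j) partial i (partial j f) x.

Definition C1 f : Prop :=
  forall i, (forall x, derivable f x (delta_mx 0 i)) /\ continuous (partial i f).

Definition C2 f : Prop := C1 f /\ forall i, C1 (partial i f).

Definition C2_compact_support f : Prop :=
  C2 f /\ compact (closure [set x | f x != 0]).

End calculus.

Section matrices.
Context {R : realType} {k : nat}.
Implicit Types A B : 'M[R]_k.

(* A : B, i.e. tr(A B) *)
Definition frobenius A B : R := \sum_i \sum_j A j i * B i j.

Definition spd A : Prop :=
  A^T = A /\ forall v : 'rV[R]_k, v != 0 -> 0 < (v *m A *m v^T) 0 0.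

End matrices.

Section target.
Context {R : realType} {k : nat}.
Implicit Types (Pi : probability 'rV[R]_k R) (p : 'rV[R]_k -> R).

Definition has_lebesgue_density Pi p : Prop :=
  [/\ measurable_fun setT p, forall x, 0 <= p x &
      forall A, measurable A -> Pi A = (\int[lebesgue_rV k]_(x in A) (p x)%:E)%E].

(* log p is finite, differentiable, and its gradient is Lipschitz (for the sup
   norm of 'rV, equivalent to the Euclidean one). *)
Definition lipschitz_score p : Prop :=
  [/\ forall x, 0 < p x,
      forall x, differentiable (fun y => ln (p y)) x &
      lipschitz (gradient (fun y => ln (p y)))].

Definition second_moments Pi : Prop :=
  forall i, (fun x : 'rV[R]_k => x 0 i) \in Lfun Pi 2%:E.

(* Var_{X ~ Pi} (h X) *)
Definition variance_mx Pi (h : 'rV[R]_k -> 'rV[R]_k) : 'M[R]_k :=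
  \matrix_(i, j) fine (covariance Pi (fun x => h x 0 i) (fun x => h x 0 j)).

(* G^L, with Sigma = Var_{X ~ Pi} (grad log p (X)). *)
Definition langevin_generator Pi p (L : 'M[R]_k) (f : 'rV[R]_k -> R)
    (x : 'rV[R]_k) : R :=
  let score := gradient (fun y => ln (p y)) in
  let A := (frobenius L (variance_mx Pi score))^-1 *: L in
  k%:R * (frobenius A (hessian f x)
          + (score x *m A *m (gradient f x)^T) 0 0).

End target.

Section decay_rate.
Context {R : realType} {k : nat}.

Definition linear_observables : set ('rV[R]_k -> R) :=
  [set f | exists2 v : 'rV[R]_k, v != 0 & f = fun x => (v *m x^T) 0 0].

Definition right_quotient0 (c : R -> R) (t : R) : R := t^-1 * (c t - c 0).

Definition right_derivable0 (c : R -> R) : Prop :=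
  cvg (right_quotient0 c t @[t --> 0^'+]).

Definition right_derivative0 (c : R -> R) : R :=
  lim (right_quotient0 c t @[t --> 0^'+]).

End decay_rate.

Section diffusions.
Context {R : realType} {k : nat}.
Implicit Types (Pi : probability 'rV[R]_k R)
  (Q : R -> R.-pker 'rV[R]_k ~> 'rV[R]_k).

(* Time ranges over [0, +oo[: Q t and X t are irrelevant for t < 0. *)
Definition transition_function Q : Prop :=
  (forall x A, measurable A -> Q 0 x A = \d_x A) /\
  forall s t, 0 <= s -> 0 <= t -> forall x A, measurable A ->
    Q (s + t) x A = (\int[Q s x]_y Q t y A)%E.

Definition transition_op Q (t : R) (f : 'rV[R]_k -> R) (x : 'rV[R]_k) : R :=
  \int[Q t x]_y f y.

(* (Q_t f - f)/t --> G f in L^2(Pi) for every f in C^2_c.  Only this pointwise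
   domain is prescribed, where a second-order operator G makes classical sense;
   the full L^2(Pi) generator of Q is then a closed extension of G. *)
Definition has_L2_generator Pi Q
    (G : ('rV[R]_k -> R) -> 'rV[R]_k -> R) : Prop :=
  forall f, C2_compact_support f ->
    let rest t x := t^-1 * (transition_op Q t f x - f x) - G f x in
    'N[Pi]_2%:E[EFin \o rest t]%E @[t --> 0^'+] --> 0%E.

Section process.
Context {d : measure_display} {Om : measurableType d} (P : probability Om R).
Variable X : R -> Om -> 'rV[R]_k.

Definition natural_filtration (t : R) : set (set Om) :=
  <<s \bigcup_(s in `[0, t]) preimage_set_system setT (X s) measurable >>.

(* X is Markov for its natural filtration:
   P(X_(s+t) \in B | F_s) = Q_t(X_s, B) almost surely. *)
Definition markov_process Q : Prop :=
  (forall t, 0 <= t -> measurable_fun setT (X t)) /\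
  forall s t, 0 <= s -> 0 <= t ->
    forall E B, natural_filtration s E -> measurable B ->
      P (E `&` X (s + t) @^-1` B) = (\int[P]_(w in E) Q t (X s w) B)%E.

Definition stationary_diffusion Pi
    (G : ('rV[R]_k -> R) -> 'rV[R]_k -> R) : Prop :=
  {ae P, forall w, {within `[0, +oo[, continuous (fun t => X t w)}} /\
  (forall t, 0 <= t -> forall A, measurable A -> P (X t @^-1` A) = Pi A) /\
  exists Q, [/\ transition_function Q, markov_process Q &
                has_L2_generator Pi Q G].

Definition correlation (U V : Om -> R) : R :=
  fine (covariance P U V) /
    (Num.sqrt (fine 'V_P[U]) * Num.sqrt (fine 'V_P[V])).

Definition autocorrelation (f : 'rV[R]_k -> R) (t : R) : R :=
  correlation (f \o X 0) (f \o X t).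

Definition worst_decay_rate : R :=
  inf [set `|right_derivative0 (autocorrelation f)| | f in linear_observables].

End process.
End diffusions.

(* Main.v *)
Require Import Defs.
From HB Require Import structures.
From mathcomp Require Import all_boot all_order all_algebra.
From mathcomp Require Import all_classical all_reals all_analysis.
From mathcomp Require Import measurable_realfun ring lra.

Import Order.TTheory GRing.Theory Num.Theory.
Import numFieldNormedType.Exports.
Local Open Scope classical_set_scope.
Local Open Scope ring_scope.

(** Let f(x) = v'x and let G be the generator.  By stationarity the derivative
    at lag 0 of the autocovariance of f is E[f Gf], and E[Gh] = 0 for h in
    C^2_c; applied to (truncations of) h = f^2, for which
    Gh = 2 f Gf + 2k v L v' / (L : Sigma), this gives
    E[f Gf] = - k v L v' / (L : Sigma) without any integration by parts.
    Hence the decay rate of f is k (v L v') / ((L : Sigma) (v Gamma v')), which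
    for L = Gamma is the constant k / (Gamma : Sigma).  If lam is the infimum of
    these rates over v, then k L - lam (L : Sigma) Gamma is positive
    semidefinite, and pairing it with Sigma >= 0 gives
    lam <= k / (Gamma : Sigma).

    The linear f is not compactly supported.  Let f_n = f chi_n with
    chi_n(x) = (1 - |x|^2 / (n+1))_+^3.  The score grows linearly and the second
    moments are finite, so f_n -> f and G f_n -> Gf in L^2; and the difference
    quotients of t |-> E[u(X_0) h(X_t)] are bounded by |u| |Gh| uniformly in t,
    so that the limits n -> oo and t -> 0+ can be exchanged.

    L : Sigma > 0 because otherwise the score is constant and the density is
    the exponential of an affine function, which is not integrable. *)

Set Implicit Arguments.
Unset Strict Implicit.

(** * Square-integrable functions *)

(** The generator is prescribed only on C^2_c and only through a limit at t = 0+. So no formula for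
    the derivative of [transition_op] at positive times is at hand, nor anything direct about an
    unbounded observable. The uniform bound on difference quotients makes up for both, and it is
    obtained from the process itself: [0, t] is cut into n equal steps, each increment of h is
    conditioned at its left end by the Markov property while u stays at X_0, and every X_s has law
    Pi. Cauchy-Schwarz then gives the same bound for each step, namely (t / n) |u| |Gh| up to o(1 /
    n), and the n bounds add up.

    A preliminary obstacle is that the Markov property speaks of events and the generator of
    functions. A linear functional that is bounded for the sup norm and vanishes on indicators
    vanishes on all bounded measurable functions; this is used twice, for the function of the future
    and for the function of X_0. *)

Lemma cvg_near_eq {T : Type} {U : nbhsType} (F : set_system T) {FF : Filter F}
    (f g : T -> U) (l : U) :
  (\forall x \near F, f x = g x) -> f @ F --> l -> g @ F --> l.
Proof. by move=> fg; apply: cvg_trans; exact: near_eq_cvg. Qed.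

Lemma cvg_norm_le {R : realType} (u : nat -> R) (l M : R) :
  u @ \oo --> l -> (forall n, `|u n| <= M) -> `|l| <= M.
Proof.
move=> ul uM; apply: (ler_cvg_to (cvg_norm ul) (cvg_cst M)).
exact: nearW.
Qed.

Section square_integrability.
Context {d} {T : measurableType d} {R : realType} (P : probability T R).
Implicit Types f g h : T -> R.

Local Notation L1 f := (P.-integrable setT (EFin \o f)).

Lemma integrable_dominated f g : measurable_fun setT f ->
  (forall x, `|f x| <= g x) -> L1 g -> L1 f.
Proof.
move=> mf fg; apply: le_integrable => //; first exact/measurable_EFinP.
move=> x _ /=; rewrite lee_fin; apply: (le_trans (fg x)); exact: ler_norm.
Qed.

Lemma integrable_bounded f (M : R) : measurable_fun setT f ->
  (forall x, `|f x| <= M) -> L1 f.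
Proof.
move=> mf fM; apply: (@integrable_dominated _ (cst M)) => //.
exact: finite_measure_integrable_cst.
Qed.

Lemma integrableRD f g : L1 f -> L1 g -> L1 (fun x => f x + g x).
Proof. by move=> If Ig; exact: (integrableD measurableT If Ig). Qed.

Lemma integrableRB f g : L1 f -> L1 g -> L1 (fun x => f x - g x).
Proof. by move=> If Ig; exact: (integrableB measurableT If Ig). Qed.

Lemma integrableRZ c f : L1 f -> L1 (fun x => c * f x).
Proof. by move=> If; exact: (integrableZl measurableT c If). Qed.

Lemma integrableR_sum (I : finType) (f : I -> T -> R) :
  (forall i, L1 (f i)) -> L1 (fun x => \sum_i f i x).
Proof.
move=> If; have := @integrable_sum _ _ _ P setT measurableT _ (index_enum I) xpredT (fun i
  => EFin \o f i) (fun i _ => If i).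

by congr (_.-integrable _ _); apply/funext => x /=; rewrite sumEFin.
Qed.

Lemma Rintegral_prob_cst c : \int[P]_x c = c.
Proof. by rewrite Rintegral_cst//= probability_setT mulr1. Qed.

Definition square_integrable f := measurable_fun setT f /\ L1 (fun x => f x ^+ 2).

Lemma square_integrable_measurable f : square_integrable f -> measurable_fun setT f.
Proof. by case. Qed.

Lemma square_integrable_bounded f (M : R) : measurable_fun setT f ->
  (forall x, `|f x| <= M) -> square_integrable f.
Proof.
move=> mf fM; split => //; apply: (@integrable_bounded _ (M ^+ 2)).
  exact: measurable_funX.
by move=> x; rewrite normrX lerXn2r ?nnegrE ?normr_ge0 ?(le_trans _ (fM x)).
Qed.

Lemma square_integrable_mul f g : square_integrable f -> square_integrable g ->
  L1 (fun x => f x * g x).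
Proof.
move=> [mf If] [mg Ig].
apply: (@integrable_dominated _ (fun x => f x ^+ 2 + g x ^+ 2)); last first.
- exact: integrableRD.
- move=> x; rewrite normrM -(real_normK (num_real (f x))).
  rewrite -(real_normK (num_real (g x))).
  have := sqr_ge0 (`|f x| - `|g x|); have := normr_ge0 (f x).
  have := normr_ge0 (g x); nra.
- exact: measurable_funM.
Qed.

Lemma square_integrable_integrable f : square_integrable f -> L1 f.
Proof.
move=> sf; have s1 : square_integrable (cst 1) by apply:
  (@square_integrable_bounded _ 1) => // x; rewrite normr1.
have := square_integrable_mul sf s1.
by congr (_.-integrable _ _); apply/funext => x /=; rewrite mulr1.
Qed.

Lemma square_integrable_dominated f g : measurable_fun setT f ->
  (forall x, `|f x| <= g x) -> square_integrable g -> square_integrable f.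
Proof.
move=> mf fg [mg Ig]; split => //.
apply: integrable_dominated Ig; first exact: measurable_funX.
by move=> x; rewrite normrX lerXn2r ?nnegrE ?normr_ge0 ?(le_trans _ (fg x)).
Qed.

Lemma square_integrableZ c f : square_integrable f -> square_integrable (fun x => c * f x).
Proof.
move=> [mf If]; split; first exact: measurable_funM.
have := integrableRZ (c ^+ 2) If.
by congr (_.-integrable _ _); apply/funext => x /=; rewrite exprMn.
Qed.

Lemma square_integrableD f g : square_integrable f -> square_integrable g ->
  square_integrable (fun x => f x + g x).
Proof.
move=> sf sg; split.
  by apply: measurable_funD; exact: square_integrable_measurable.
have -> : (fun x => (f x + g x) ^+ 2) =
    (fun x => f x ^+ 2 + (2 * (f x * g x) + g x ^+ 2)).
  by apply/funext => x; ring.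
apply: integrableRD; first by case: sf.
by apply: integrableRD; [apply: integrableRZ; exact: square_integrable_mul|case: sg].
Qed.

Lemma square_integrableB f g : square_integrable f -> square_integrable g ->
  square_integrable (fun x => f x - g x).
Proof.
move=> sf /(square_integrableZ (-1)) /(square_integrableD sf); congr (square_integrable _).
by apply/funext => x; rewrite mulN1r.
Qed.

Lemma square_integrable_norm f : square_integrable f -> square_integrable (fun x => `|f x|).
Proof.
move=> [mf If]; split; first exact: measurableT_comp.
move: If; congr (_.-integrable _ _); apply/funext => x /=.
by rewrite real_normK ?num_real.
Qed.

Lemma square_integrable_sum (I : finType) (f : I -> T -> R) :
  (forall i, square_integrable (f i)) -> square_integrable (fun x => \sum_i f i x).
Proof.
move=> sf; rewrite -[X in square_integrable X]/(fun x => _).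
elim: (index_enum I) => [|i s IH].
  under eq_fun do rewrite big_nil.
  by apply: (@square_integrable_bounded _ 0) => // x; rewrite normr0.
by under eq_fun do rewrite big_cons; exact: square_integrableD.
Qed.

Lemma Rintegral_sum (I : finType) (f : I -> T -> R) :
  (forall i, L1 (f i)) ->
  \int[P]_x (\sum_i f i x) = \sum_i \int[P]_x f i x.
Proof.
move=> If.
suff: forall s : seq I, P.-integrable setT (EFin \o (fun x => \sum_(i <- s) f i x)) /\
    \int[P]_x (\sum_(i <- s) f i x) = \sum_(i <- s) \int[P]_x f i x by move=> /(_
      (index_enum I))[].
elim=> [|i s [IH1 IH2]].
  under eq_fun do rewrite big_nil.
  rewrite big_nil Rintegral_prob_cst; split => //.
  exact: finite_measure_integrable_cst.
under eq_fun do rewrite big_cons.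
split; first exact: integrableRD.
by rewrite RintegralD// IH2 big_cons.
Qed.

Definition l2norm f : R := Num.sqrt (\int[P]_x (f x ^+ 2)).

Lemma l2norm_ge0 f : 0 <= l2norm f.
Proof. exact: sqrtr_ge0. Qed.

Lemma l2norm_sqr f : l2norm f ^+ 2 = \int[P]_x (f x ^+ 2).
Proof. by rewrite sqr_sqrtr// Rintegral_ge0// => x _; exact: sqr_ge0. Qed.

Lemma cauchy_schwarz f g : square_integrable f -> square_integrable g ->
  `|\int[P]_x (f x * g x)| <= l2norm f * l2norm g.
Proof.
move=> sf sg.
set a := \int[P]_x (f x ^+ 2); set b := \int[P]_x (g x ^+ 2).
set c := \int[P]_x (f x * g x).
have quad (s t : R) : 0 <= s ^+ 2 * a + 2 * (s * t) * c + t ^+ 2 * b.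
  have : 0 <= \int[P]_x ((s * f x + t * g x) ^+ 2).
    by apply: Rintegral_ge0 => x _; exact: sqr_ge0.
  have -> : (fun x => (s * f x + t * g x) ^+ 2) =
      (fun x => (s ^+ 2 * f x ^+ 2 + 2 * (s * t) * (f x * g x)) + t ^+ 2 * g x ^+ 2).
    by apply/funext => x; ring.
  have [_ If] := sf; have [_ Ig] := sg; have Ifg := square_integrable_mul sf sg.
  rewrite RintegralD//; last 2 first.
  - by apply: integrableRD; exact: integrableRZ.
  - exact: integrableRZ.
  rewrite RintegralD ?RintegralZl//; exact: integrableRZ.
have a0 : 0 <= a by apply: Rintegral_ge0 => x _; exact: sqr_ge0.
have b0 : 0 <= b by apply: Rintegral_ge0 => x _; exact: sqr_ge0.
rewrite -(@ler_pXn2r _ 2) ?nnegrE ?mulr_ge0 ?l2norm_ge0//.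
rewrite exprMn !l2norm_sqr -/a -/b real_normK ?num_real//.
have [b_eq0|bn0] := eqVneq b 0.
  have [->|cn0] := eqVneq c 0; first by rewrite expr0n/= b_eq0 mulr0.
  (* With b = 0 the form is affine in t, and this t gives it the value -1. *)
  have := quad 1 (- (a + 1) / (2 * c)); rewrite b_eq0.
  have -> : 1 ^+ 2 * a + 2 * (1 * (- (a + 1) / (2 * c))) * c +
    (- (a + 1) / (2 * c)) ^+ 2 * 0 = -1 by field.
  by rewrite ler0N1.
have bp : 0 < b by rewrite lt0r bn0.
(* At s = b the form is minimal for t = - c; this choice involves no division. *)
have := quad b (- c).
have -> : b ^+ 2 * a + 2 * (b * - c) * c + (- c) ^+ 2 * b = b * (a * b - c ^+ 2) by ring.
by rewrite pmulr_rge0// subr_ge0.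
Qed.

Lemma l2normD f g : square_integrable f -> square_integrable g ->
  l2norm (fun x => f x + g x) <= l2norm f + l2norm g.
Proof.
move=> sf sg; rewrite -(@ler_pXn2r _ 2) ?nnegrE ?addr_ge0 ?l2norm_ge0//.
rewrite sqrrD !l2norm_sqr.
have -> : (fun x => (f x + g x) ^+ 2) =
    (fun x => (f x ^+ 2 + 2 * (f x * g x)) + g x ^+ 2).
  by apply/funext => x; ring.
have [_ If] := sf; have [_ Ig] := sg; have Ifg := square_integrable_mul sf sg.
rewrite RintegralD//; last by apply: integrableRD => //; exact: integrableRZ.
rewrite RintegralD//; last exact: integrableRZ.
rewrite RintegralZl// lerD2r lerD2l -[leRHS]mulr_natl.
apply: ler_wpM2l; first by rewrite ler0n.
by rewrite (le_trans (ler_norm _))// cauchy_schwarz.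
Qed.

Lemma l2normZ c f : square_integrable f -> l2norm (fun x => c * f x) = `|c| * l2norm f.
Proof.
move=> [_ If]; rewrite /l2norm; under eq_Rintegral do rewrite exprMn.
by rewrite RintegralZl// sqrtrM ?sqr_ge0// sqrtr_sqr.
Qed.

Lemma dominated_cvg_Rintegral (f_ : nat -> T -> R) f g :
  (forall n, measurable_fun setT (f_ n)) ->
  (forall x, f_ ^~ x @ \oo --> f x) ->
  L1 g -> (forall n x, `|f_ n x| <= g x) ->
  L1 f /\ \int[P]_x f_ n x @[n --> \oo] --> \int[P]_x f x.
Proof.
move=> mf_ f_f Ig f_g.
have mf : measurable_fun setT f.
  by apply: (measurable_fun_cvg mf_) => x _; exact: f_f.
have [] := @dominated_convergence _ _ _ P setT measurableT
  (fun n => EFin \o f_ n) (EFin \o f) (EFin \o g).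
- by move=> n; exact/measurable_EFinP.
- exact/measurable_EFinP.
- by apply: aeW => x _; apply: cvg_EFin; [exact: nearW|exact: f_f].
- exact: Ig.
- by apply: aeW => x n _ /=; rewrite lee_fin.
move=> If _ cvgf; split => //.
have fin : (\int[P]_x (f x)%:E)%E \is a fin_num by exact: integrable_fin_num.
by rewrite /Rintegral; apply: fine_cvg; rewrite fineK.
Qed.

Lemma dominated_cvg_l2norm (f_ : nat -> T -> R) f g :
  (forall n, measurable_fun setT (f_ n)) ->
  (forall x, f_ ^~ x @ \oo --> f x) ->
  square_integrable g -> (forall n x, `|f_ n x| <= g x) ->
  l2norm (f_ n) @[n --> \oo] --> l2norm f.
Proof.
move=> mf_ f_f sg f_g.
apply: (@continuous_cvg _ _ _ _ _ _ (@Num.sqrt R)); first exact: sqrt_continuous.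
have [_ Ig] := sg.
have [] // := @dominated_cvg_Rintegral (fun n x => f_ n x ^+ 2) (fun x => f x ^+ 2)
  (fun x => g x ^+ 2).
- by move=> n; exact: measurable_funX.
- by move=> x; apply: cvgM; exact: f_f.
- by move=> n x; rewrite normrX lerXn2r ?nnegrE ?normr_ge0 ?(le_trans _ (f_g n x)).
Qed.

Lemma l2norm0 : l2norm (fun=> 0) = 0.
Proof.
by rewrite /l2norm; under eq_Rintegral do rewrite expr0n/=;
  rewrite Rintegral_cst// mul0r sqrtr0.
Qed.

(** Transfers the convergence in [has_L2_generator] to the real-valued [l2norm]. *)
Lemma Lnorm2E f : square_integrable f -> 'N[P]_2%:E[EFin \o f]%E = (l2norm f)%:E.
Proof.
move=> [mf If]; rewrite unlock/=.
have -> : (\int[P]_x (`|(f x)%:E| `^ 2) = \int[P]_x (f x ^+ 2)%:E)%E.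
  apply: eq_integral => x _; rewrite abse_EFin poweR_EFin powR_mulrn//.
  by rewrite real_normK ?num_real.
have fin : (\int[P]_x (f x ^+ 2)%:E)%E \is a fin_num by exact: integrable_fin_num.
rewrite -(fineK fin) poweR_EFin /l2norm /Rintegral powR12_sqrt//.
by apply: fine_ge0; apply: integral_ge0 => x _; rewrite lee_fin sqr_ge0.
Qed.

End square_integrability.

(** * Bounded measurable functions and kernels *)

Section bounded_measurability.
Context {d} {T : measurableType d} {R : realType}.
Implicit Types f g : T -> R.

Definition bounded_measurable f := measurable_fun setT f /\ exists M, forall x, `|f x| <= M.

Lemma bounded_measurable_cst c : bounded_measurable (cst c).
Proof. by split => //; exists `|c|. Qed.

Lemma bounded_measurable_indic A : measurable A -> bounded_measurable (\1_A : T -> R).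
Proof.
move=> mA; split; first exact: measurable_indic.
by exists 1 => x; rewrite indicE; case: (x \in A); rewrite ?normr1 ?normr0.
Qed.

Lemma bounded_measurableD f g : bounded_measurable f -> bounded_measurable g ->
  bounded_measurable (fun x => f x + g x).
Proof.
move=> [mf [M fM]] [mg [N gN]]; split; first exact: measurable_funD.
by exists (M + N) => x; rewrite (le_trans (ler_normD _ _))// lerD.
Qed.

Lemma bounded_measurableZ c f : bounded_measurable f ->
  bounded_measurable (fun x => c * f x).
Proof.
move=> [mf [M fM]]; split; first exact: measurable_funM.
by exists (`|c| * M) => x; rewrite normrM ler_wpM2l.
Qed.

Lemma bounded_measurableB f g : bounded_measurable f -> bounded_measurable g ->
  bounded_measurable (fun x => f x - g x).
Proof.
move=> bf /(bounded_measurableZ (-1)) /(bounded_measurableD bf); congr bounded_measurable.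
by apply/funext => x; rewrite mulN1r.
Qed.

Lemma bounded_measurableM f g : bounded_measurable f -> bounded_measurable g ->
  bounded_measurable (fun x => f x * g x).
Proof.
move=> [mf [M fM]] [mg [N gN]]; split; first exact: measurable_funM.
by exists (M * N) => x; rewrite normrM ler_pM.
Qed.

Lemma bounded_measurable_sum n (f : 'I_n -> T ->
  R) : (forall i, bounded_measurable (f i)) ->
  bounded_measurable (fun x => \sum_i f i x).
Proof.
move=> bf; elim: (index_enum _) => [|i s IH].
  by under eq_fun do rewrite big_nil; exact: bounded_measurable_cst.
by under eq_fun do rewrite big_cons; exact: bounded_measurableD.
Qed.

Lemma bounded_measurable_bound f : bounded_measurable f ->
  exists2 M, 0 < M & forall x, `|f x| <= M.
Proof.
move=> [_ [M fM]]; exists (`|M| + 1); first by rewrite ltr_wpDl.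
by move=> x; rewrite (le_trans (fM x))// (le_trans (ler_norm M))// lerDl.
Qed.

(** The sum counts the positive integers up to y, so the difference is a fractional part; y <= n
    ensures that no threshold is missed. *)
Lemma count_thresholds n (y : R) : 0 <= y <= n%:R ->
  0 <= y - \sum_(j < n) ((j.+1%:R : R) <= y)%R%:R <= 1.
Proof.
elim: n => [|n IH] /andP[y0 yn].
  by rewrite big_ord0 subr0 y0/= (le_trans yn).
rewrite big_ord_recr/=; have [yle|ylt] := leP y n%:R.
  have -> : (n.+1%:R <= y) = false.
    by apply/negbTE; rewrite -ltNge (le_lt_trans yle)// ltr_nat.
  by rewrite addr0; apply: IH; rewrite y0.
rewrite (eq_bigr (fun=> 1)); last first.
  by move=> i _; rewrite (le_trans _ (ltW ylt))// ler_nat.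
rewrite sumr_const card_ord.
have [h|h] := leP n.+1%:R y; last first.
  by rewrite addr0 subr_ge0 ltW//= lerBlDr addrC natr1.
by have -> : y = n.+1%:R; [apply/le_anti; rewrite yn|rewrite -natr1 subrr lexx ler01].
Qed.

(* Bounded functions are uniform limits of the step functions
   n^-1 * \sum_(j < n) \1_(j+1 <= n f). *)
Lemma bounded_functional_eq0 (F : (T -> R) -> R) (C : R) :
  (forall A, measurable A -> F \1_A = 0) ->
  (forall f g, bounded_measurable f -> bounded_measurable g ->
    F (fun x => f x + g x) = F f + F g) ->
  (forall c f, bounded_measurable f -> F (fun x => c * f x) = c * F f) ->
  (forall f M, bounded_measurable f -> (forall x, `|f x| <= M) -> `|F f| <= C * M) ->
  forall f, bounded_measurable f -> F f = 0.
Proof.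
move=> F_indic FD FZ FC f bf.
have F_cst c : F (cst c) = 0.
  have -> : (cst c : T -> R) = (fun x => c * \1_setT x).
    by apply: funext => x; rewrite indicT mulr1.
  by rewrite FZ ?F_indic ?mulr0//; exact: bounded_measurable_indic.
have F_sum n (h : 'I_n -> T -> R) : (forall i, bounded_measurable (h i)) ->
    (forall i, F (h i) = 0) -> F (fun x => \sum_i h i x) = 0.
  move=> bh Fh.
  suff: bounded_measurable (fun x => \sum_i h i x) /\ F (fun x => \sum_i h i x) = 0 by case.
  elim: (index_enum _) => [|i s [IH1 IH2]].
    by under eq_fun do rewrite big_nil; split; [exact: bounded_measurable_cst|exact: F_cst].
  under eq_fun do rewrite big_cons; split; first exact: bounded_measurableD.
  by rewrite FD// Fh IH2 addr0.
(* An affine rescaling brings [f] into [0, 1]; the added constant costs nothing because [F] kills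
   constants. *)
suff Fpos g : bounded_measurable g -> (forall x, 0 <= g x <= 1) -> F g = 0.
  have [M M0 fM] := bounded_measurable_bound bf.
  have bg : bounded_measurable (fun x => (2 * M)^-1 * (f x + M)).
    by apply: bounded_measurableZ; apply: bounded_measurableD => //;
      exact: bounded_measurable_cst.
  have -> : f = (fun x => (2 * M) * ((2 * M)^-1 * (f x + M)) + cst (- M) x).
    by apply/funext => x /=; field; rewrite gt_eqF.
  rewrite FD ?F_cst ?addr0; [|exact: bounded_measurableZ|exact: bounded_measurable_cst].
  rewrite FZ// Fpos ?mulr0// => x; have := fM x; rewrite ler_norml => /andP[f1 f2].
  rewrite mulr_ge0 ?invr_ge0//= ?(ltW (mulr_gt0 _ M0))//; last lra.
  by rewrite ler_pdivrMl ?mulr_gt0//; lra.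
move=> bg g01.
pose step n x : R := \sum_(j < n) \1_[set x | j.+1%:R <= n%:R * g x] x.
have mset n j : measurable [set x | (j.+1%:R : R) <= n%:R * g x].
  rewrite -[X in measurable X]setTI.
  have mg : measurable_fun setT (fun x => n%:R * g x).
    by apply: measurable_funM => //; case: bg.
  rewrite (_ : [set x | _] = (fun x => n%:R * g x) @^-1` `[j.+1%:R, +oo[%classic).
    by apply: mg => //; exact: measurable_itv.
  by apply/seteqP; split => x /=; rewrite in_itv/= andbT.
have bstep n : bounded_measurable (step n) by apply: bounded_measurable_sum => i;
  exact: bounded_measurable_indic.
have Fstep n : F (step n) = 0.
  by apply: F_sum => i; [exact: bounded_measurable_indic|exact: F_indic].
have bound n : (0 < n)%N -> `|F g| <= C * n%:R^-1.
  move=> n0; have n0' : (0 : R) < n%:R by rewrite ltr0n.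
  have -> : F g = F (fun x => n%:R^-1 * (n%:R * g x - step n x)).
    have -> : (fun x => n%:R^-1 * (n%:R * g x - step n x)) =
        (fun x => g x + (- n%:R^-1) * step n x).
      by apply/funext => x; field; rewrite gt_eqF.
    by rewrite FD ?FZ ?Fstep ?mulr0 ?addr0//; exact: bounded_measurableZ.
  apply: FC => [|x].
    by apply: bounded_measurableZ; apply: bounded_measurableB => //;
      exact: bounded_measurableZ.
  rewrite normrM ger0_norm ?invr_ge0 ?ler0n// -[leRHS]mulr1.
  rewrite ler_pM2l ?invr_gt0//.
  have /andP[g0 g1] := g01 x.
  have := @count_thresholds n (n%:R * g x).
  rewrite mulr_ge0 ?ler0n//= -[X in _ <= X -> _]mulr1 ler_pM2l// => /(_ g1).
  have -> : \sum_(j < n) ((j.+1%:R : R) <= n%:R * g x)%R%:R = step n x.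
    apply: eq_bigr => i _; rewrite indicE; congr (_%:R); congr nat_of_bool.
    by apply/idP/idP; rewrite inE.
  by move=> /andP[a0 a1]; rewrite ger0_norm.
apply/eqP; rewrite -normr_le0.
apply/ler_addgt0Pl => e e0; rewrite addr0.
have [C0|C0] := leP C 0.
  apply: (le_trans (bound 1%N _)) => //; rewrite invr1 mulr1.
  by rewrite (le_trans C0)// ltW.
pose n := (Num.trunc (C / e)).+1.
apply: (le_trans (bound n _)) => //.
rewrite ler_pdivrMr ?ltr0n// mulrC -ler_pdivrMr//.
exact/ltW/truncnS_gt.
Qed.

End bounded_measurability.

Section probability_kernels.
Context {d d'} {X : measurableType d} {Y : measurableType d'} {R : realType}.
Variable K : R.-pker X ~> Y.

Lemma kernel_integrable (g : Y -> R) x : bounded_measurable g ->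
  (K x).-integrable setT (EFin \o g).
Proof.
move=> bg; have [M M0 gM] := bounded_measurable_bound bg; case: bg => mg _.
apply: measurable_bounded_integrable => //.
- by rewrite prob_kernel ltry.
- exists M; split; first exact: num_real.
  by move=> N MN y _; apply: (le_trans (gM y)); exact: ltW.
Qed.

Lemma kernel_opD (f g : Y -> R) x : bounded_measurable f -> bounded_measurable g ->
  \int[K x]_y (f y + g y) = \int[K x]_y f y + \int[K x]_y g y.
Proof. by move=> bf bg; rewrite RintegralD//; exact: kernel_integrable. Qed.

Lemma kernel_opZ c (f : Y -> R) x : bounded_measurable f ->
  \int[K x]_y (c * f y) = c * \int[K x]_y f y.
Proof. by move=> bf; rewrite RintegralZl//; exact: kernel_integrable. Qed.

Lemma kernel_op_cst c x : \int[K x]_y c = c.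
Proof. by rewrite Rintegral_cst// prob_kernel mulr1. Qed.

Lemma kernel_fin_num A x : measurable A -> K x A \is a fin_num.
Proof.
move=> mA; rewrite ge0_fin_numE// (@le_lt_trans _ _ 1%E) ?ltry//.
by rewrite -(@prob_kernel _ _ _ _ _ K x) le_measure// inE.
Qed.

Lemma kernel_op_indic A x : measurable A -> \int[K x]_y \1_A y = fine (K x A).
Proof. by move=> mA; rewrite /Rintegral integral_indic// setIT. Qed.

Lemma kernel_op_bound (f : Y -> R) M x : bounded_measurable f -> (forall y, `|f y| <= M) ->
  `|\int[K x]_y f y| <= M.
Proof.
move=> bf fM; have If := kernel_integrable x bf.
apply: (le_trans (le_normr_Rintegral measurableT If)).
rewrite -[leRHS](kernel_op_cst M x); apply: le_Rintegral => //.
- exact: integrable_norm.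
- exact: (kernel_integrable _ (bounded_measurable_cst M)).
Qed.

Lemma bounded_measurable_kernel_op (f : Y -> R) : bounded_measurable f ->
  bounded_measurable (fun x => \int[K x]_y f y).
Proof.
move=> bf; have [M M0 fM] := bounded_measurable_bound bf; split; last first.
  by exists M => x; exact: kernel_op_bound.
(* Measurability of a kernel integral is available for nonnegative integrands, whence the shift by
   [M]. *)
have bfM : bounded_measurable (fun y => f y + cst M y) by apply:
  bounded_measurableD => //; exact: bounded_measurable_cst.
have -> : (fun x => \int[K x]_y f y) = (fun x => \int[K x]_y (f y + cst M y) - M).
  by apply/funext => x; rewrite kernel_opD// ?kernel_op_cst ?addrK//;
    exact: bounded_measurable_cst.
apply: measurable_funB => //.
apply: (measurableT_comp (fine_measurable measurableT)) => //.
apply: measurable_fun_integral_kernel.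
- by move=> U mU; exact: measurable_kernel.
- by move=> z; rewrite lee_fin/=; have := fM z; rewrite ler_norml; lra.
- by apply/measurable_EFinP; case: bfM.
Qed.

End probability_kernels.

(** * Stationary Markov processes *)

Section markov.
Context {R : realType} {k : nat} {d : measure_display} {Om : measurableType d}.
Variables (P : probability Om R) (Pi : probability 'rV[R]_k R).
Variables (X : R -> Om -> 'rV[R]_k) (Q : R -> R.-pker 'rV[R]_k ~> 'rV[R]_k).
Hypothesis mX : forall t, 0 <= t -> measurable_fun setT (X t).
Hypothesis lawX : forall t, 0 <= t -> forall A, measurable A ->
  P (X t @^-1` A) = Pi A.

Lemma integral_law t (f : 'rV[R]_k -> \bar R) : 0 <= t ->
  measurable_fun setT f -> (\int[P]_w f (X t w) = \int[Pi]_x f x)%E.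
Proof.
move=> t0 mf.
have pos (g : 'rV[R]_k -> \bar R) : measurable_fun setT g ->
    (forall x, 0 <= g x)%E -> (\int[P]_w g (X t w) = \int[Pi]_x g x)%E.
  move=> mg g0; have := @ge0_integral_pushforward _ _ _ _ _ _ (mX t0) P setT g measurableT
    mg.
  rewrite preimage_setT => <-; last by move=> y _; exact: g0.
  by apply: eq_measure_integral => [|? A mA _]; [exact: mX|exact: lawX].
rewrite integralE [RHS]integralE; congr (_ - _)%E.
- rewrite -pos//; last exact: measurable_funepos.
  by apply: eq_integral => w _; rewrite !funeposE.
- rewrite -pos//; last exact: measurable_funeneg.
  by apply: eq_integral => w _; rewrite !funenegE.
Qed.

Lemma Rintegral_law t (f : 'rV[R]_k -> R) : 0 <= t ->
  measurable_fun setT f -> \int[P]_w f (X t w) = \int[Pi]_x f x.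
Proof.
move=> t0 mf; congr fine; apply: (@integral_law t (EFin \o f)) => //.
exact/measurable_EFinP.
Qed.

Lemma integrable_law t (f : 'rV[R]_k -> R) : 0 <= t ->
  Pi.-integrable setT (EFin \o f) -> P.-integrable setT (EFin \o (fun w => f (X t w))).
Proof.
move=> t0 /integrableP[mf If]; apply/integrableP; split.
  exact: (measurableT_comp mf (mX t0)).
rewrite (@integral_law t (fun x => `|(f x)%:E|)%E) //.
exact: measurableT_comp.
Qed.

Lemma square_integrable_law t f : 0 <= t -> square_integrable Pi f ->
  square_integrable P (fun w => f (X t w)).
Proof.
move=> t0 [mf If]; split; first exact: (measurableT_comp mf (mX t0)).
exact: (integrable_law t0 If).
Qed.

Lemma l2norm_law t f : 0 <= t -> measurable_fun setT f ->
  l2norm P (fun w => f (X t w)) = l2norm Pi f.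
Proof.
move=> t0 mf; congr Num.sqrt.
by apply: (@Rintegral_law t (fun x => f x ^+ 2)) => //; exact: measurable_funX.
Qed.

Lemma bounded_measurable_law t (f : 'rV[R]_k -> R) : 0 <= t -> bounded_measurable f ->
  bounded_measurable (fun w => f (X t w)).
Proof.
move=> t0 [mf [M fM]]; split; first exact: (measurableT_comp mf (mX t0)).
by exists M => w.
Qed.

Lemma bounded_measurable_integrable (f : Om -> R) : bounded_measurable f ->
  P.-integrable setT (EFin \o f).
Proof. by move=> [mf [M fM]]; exact: integrable_bounded fM. Qed.

Lemma natural_filtration_measurable s E : 0 <= s ->
  natural_filtration X s E -> measurable E.
Proof.
move=> s0; apply: smallest_sub; first exact: sigma_algebra_measurable.
move=> A [r] /=; rewrite in_itv/= => /andP[r0 _] [B mB <-].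
exact: (mX r0).
Qed.

Hypothesis markov : forall s t, 0 <= s -> 0 <= t ->
  forall E B, natural_filtration X s E -> measurable B ->
    P (E `&` X (s + t) @^-1` B) = (\int[P]_(w in E) Q t (X s w) B)%E.

(** By the Markov property, g(X_(s+t)) minus its conditional expectation given the past up to s. *)
Let defect s t (g : 'rV[R]_k -> R) w := g (X (s + t) w) - transition_op Q t g (X s w).

Let bounded_measurable_defect s t g : 0 <= s -> 0 <= t -> bounded_measurable g ->
  bounded_measurable (defect s t g).
Proof.
move=> s0 t0 bg; apply: bounded_measurableB;
  first by apply: bounded_measurable_law => //; exact: addr_ge0.
by apply: (@bounded_measurable_law s (transition_op Q t g)) => //;
  exact: bounded_measurable_kernel_op.
Qed.

Let defect_bound s t g M w : bounded_measurable g -> (forall x, `|g x| <= M) ->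
  `|defect s t g w| <= M + M.
Proof.
move=> bg gM; rewrite (le_trans (ler_normB _ _))// lerD//.
exact: kernel_op_bound.
Qed.

(** For g an indicator this is the hypothesis [markov]; the left side is linear in g and at most 2
    sup|g|, so [bounded_functional_eq0] applies with constant 2. *)
Lemma markov_defect_indic s t E g : 0 <= s -> 0 <= t ->
  natural_filtration X s E -> bounded_measurable g ->
  \int[P]_w (\1_E w * defect s t g w) = 0.
Proof.
move=> s0 t0 FE bg; have mE := natural_filtration_measurable s0 FE.
have b1 := @bounded_measurable_indic _ _ R _ mE.
move: g bg; apply: (@bounded_functional_eq0 _ _ _ _ 2) => [A mA|f g bf bg|c f bf|f M bf fM].
- have bA := @bounded_measurable_indic _ _ R _ mA.
  have st0 := addr_ge0 s0 t0.
  have bQ : bounded_measurable (fun w => transition_op Q t \1_A (X s w)).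
    by apply: (@bounded_measurable_law s (transition_op Q t \1_A)) => //;
      exact: bounded_measurable_kernel_op.
  rewrite /defect; under eq_Rintegral do rewrite mulrBr.
  rewrite RintegralB//; last 2 first.
  - by apply: bounded_measurable_integrable; apply: bounded_measurableM => //;
    apply: bounded_measurable_law.
  - by apply: bounded_measurable_integrable; apply: bounded_measurableM.
  apply/eqP; rewrite subr_eq0; apply/eqP.
  have -> : (fun w => \1_E w * \1_A (X (s + t) w)) =
     \1_(E `&` X (s + t) @^-1` A) :> (Om -> R).
    by apply/funext => w; rewrite indicI.
  have mX' : measurable (X (s + t) @^-1` A).
    by rewrite -[X in measurable X]setTI; exact: mX.
  rewrite /Rintegral integral_indic ?setIT//; last exact: measurableI.
  congr fine; transitivity (\int[P]_(w in E) Q t (X s w) A)%E; first exact: markov.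
  rewrite [LHS]integral_mkcond.
  apply: eq_integral => w _.
  rewrite /transition_op kernel_op_indic// patchE indicE.
  case: (w \in E); rewrite ?mul1r ?mul0r// fineK//.
  exact: kernel_fin_num.
- have -> : (fun w => \1_E w * defect s t (fun x => f x + g x) w) =
      (fun w => \1_E w * defect s t f w + \1_E w * defect s t g w).
    by apply/funext => w; rewrite /defect /transition_op kernel_opD//; ring.
  by rewrite RintegralD//; apply: bounded_measurable_integrable;
    apply: bounded_measurableM => //; exact: bounded_measurable_defect.
- have -> : (fun w => \1_E w * defect s t (fun x => c * f x) w) =
      (fun w => c * (\1_E w * defect s t f w)).
    by apply/funext => w; rewrite /defect /transition_op kernel_opZ//; ring.
  by rewrite RintegralZl//; apply: bounded_measurable_integrable;
    apply: bounded_measurableM => //; exact: bounded_measurable_defect.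
- have bd : bounded_measurable (fun w => \1_E w * defect s t f w).
    by apply: bounded_measurableM => //; exact: bounded_measurable_defect.
  apply: (le_trans (le_normr_Rintegral measurableT (bounded_measurable_integrable bd))).
  rewrite -[leRHS](Rintegral_prob_cst P).
  apply: le_Rintegral => //.
  + by apply: integrable_norm; exact: bounded_measurable_integrable.
  + by apply: bounded_measurable_integrable; exact: bounded_measurable_cst.
  + move=> w _; rewrite normrM mulrDl mul1r -[leRHS]mul1r ler_pM//.
      by rewrite indicE; case: (_ \in _); rewrite ?normr1 ?normr0.
    exact: defect_bound.
Qed.

(** Conditioning takes place at time s while [h] stays at time 0, as the telescoping over successive
    steps requires. The events X_0 in A belong to the past of s, so indicators h are covered by
    [markov_defect_indic], and [bounded_functional_eq0] is applied once more, now in h. *)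
Lemma markov_bounded_measurable s t h g : 0 <= s -> 0 <= t -> bounded_measurable h ->
  bounded_measurable g ->
  \int[P]_w (h (X 0 w) * g (X (s + t) w)) =
  \int[P]_w (h (X 0 w) * transition_op Q t g (X s w)).
Proof.
move=> s0 t0 bh bg; have bD := bounded_measurable_defect s0 t0 bg.
suff: \int[P]_w (h (X 0 w) * defect s t g w) = 0.
  rewrite /defect; under eq_Rintegral do rewrite mulrBr.
  rewrite RintegralB//; first by move/eqP; rewrite subr_eq0 => /eqP.
    apply: bounded_measurable_integrable; apply: bounded_measurableM;
      apply: bounded_measurable_law => //.
    exact: addr_ge0.
  apply: bounded_measurable_integrable; apply: bounded_measurableM;
    first exact: bounded_measurable_law.
  by apply: (@bounded_measurable_law s (transition_op Q t g)) => //;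
    exact: bounded_measurable_kernel_op.
have [M M0 DM] := bounded_measurable_bound bD.
move: h bh; apply: (@bounded_functional_eq0 _ _ _ _ M) => [A mA|f h bf bh|c f bf|f N bf fN].
- apply: (@markov_defect_indic s t (X 0 @^-1` A)) => //.
  apply: sub_sigma_algebra; exists 0; first by rewrite /= in_itv/= lexx.
  by exists A => //; rewrite setTI.
- under eq_Rintegral do rewrite mulrDl.
  by rewrite RintegralD//; apply: bounded_measurable_integrable;
    apply: bounded_measurableM => //; exact: bounded_measurable_law.
- under eq_Rintegral do rewrite -mulrA.
  by rewrite RintegralZl//; apply: bounded_measurable_integrable;
    apply: bounded_measurableM => //; exact: bounded_measurable_law.
- have bd : bounded_measurable (fun w => f (X 0 w) * defect s t g w).
    by apply: bounded_measurableM => //; exact: bounded_measurable_law.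
  apply: (le_trans (le_normr_Rintegral measurableT (bounded_measurable_integrable bd))).
  rewrite -[leRHS](Rintegral_prob_cst P).
  apply: le_Rintegral => //.
  + by apply: integrable_norm; exact: bounded_measurable_integrable.
  + by apply: bounded_measurable_integrable; exact: bounded_measurable_cst.
  + by move=> w _; rewrite normrM mulrC ler_pM.
Qed.

End markov.

(** * The generator at small lags *)

Section generator_estimates.
Context {R : realType} {k : nat} {d : measure_display} {Om : measurableType d}.
Variables (P : probability Om R) (Pi : probability 'rV[R]_k R).
Variables (X : R -> Om -> 'rV[R]_k) (Q : R -> R.-pker 'rV[R]_k ~> 'rV[R]_k).
Variable G : ('rV[R]_k -> R) -> 'rV[R]_k -> R.
Hypothesis mX : forall t, 0 <= t -> measurable_fun setT (X t).
Hypothesis lawX : forall t, 0 <= t -> forall A, measurable A ->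
  P (X t @^-1` A) = Pi A.
Hypothesis markov : forall s t, 0 <= s -> 0 <= t ->
  forall E B, natural_filtration X s E -> measurable B ->
    P (E `&` X (s + t) @^-1` B) = (\int[P]_(w in E) Q t (X s w) B)%E.
Hypothesis gen : has_L2_generator Pi Q G.
Implicit Types u h : 'rV[R]_k -> R.

(** [G] is an arbitrary operator in this section, so the integrability of [G h] has to be part of
    the definition. *)
Definition core h := [/\ C2_compact_support h, bounded_measurable h & square_integrable Pi
  (G h)].

Let rest h t x := t^-1 * (transition_op Q t h x - h x) - G h x.

Let bounded_measurable_square_integrable h : bounded_measurable h -> square_integrable Pi h.
Proof. by move=> [mh [M hM]]; exact: square_integrable_bounded hM. Qed.

Let bounded_measurable_incr h t : bounded_measurable h ->
  bounded_measurable (fun x => transition_op Q t h x - h x).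
Proof. by move=> bh; apply: bounded_measurableB => //;
  exact: bounded_measurable_kernel_op. Qed.

Let square_integrable_rest h t : core h -> square_integrable Pi (rest h t).
Proof.
move=> [_ bh sG]; apply: square_integrableB => //; apply: square_integrableZ;
  apply: bounded_measurable_square_integrable.
exact: bounded_measurable_incr.
Qed.

Let cvg_rest h : core h -> l2norm Pi (rest h t) @[t --> 0^'+] --> 0.
Proof.
move=> ch; have [c2 _ _] := ch; have := gen c2.
rewrite -[X in _ --> X -> _]/(0%:E) => /fine_cvg.
apply: cvg_near_eq; near=> t => /=.
by rewrite Lnorm2E//; exact: (square_integrable_rest t ch).
Unshelve. all: by end_near. Qed.

(** Not centred: by stationarity the product of the means is the same at all lags and cancels in
    difference quotients. *)
Definition lag_moment u h t : R := \int[P]_w (u (X 0 w) * h (X t w)).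

Let lag_momentS u h s t : 0 <= s -> 0 <= t -> bounded_measurable u ->
  bounded_measurable h ->
  lag_moment u h (s + t) - lag_moment u h s =
  \int[P]_w (u (X 0 w) * (transition_op Q t h (X s w) - h (X s w))).
Proof.
move=> s0 t0 bu bh; rewrite /lag_moment (markov_bounded_measurable mX markov)//.
under [RHS]eq_Rintegral do rewrite mulrBr.
have b0 := bounded_measurable_law mX (lexx 0) bu.
rewrite RintegralB//; apply: bounded_measurable_integrable;
  apply: bounded_measurableM => //.
  by apply: (bounded_measurable_law (f := transition_op Q t h) mX) => //;
    exact: bounded_measurable_kernel_op.
exact: (bounded_measurable_law mX).
Qed.

Let lag_moment_incr u h t : 0 < t -> bounded_measurable u -> core h ->
  t^-1 * (lag_moment u h t - lag_moment u h 0) =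
  \int[Pi]_x (u x * rest h t x) + \int[Pi]_x (u x * G h x).
Proof.
move=> t0 bu ch; have [_ bh sG] := ch.
rewrite -[X in lag_moment u h X - _]add0r lag_momentS ?lexx ?(ltW t0)//.
have bI := bounded_measurable_incr t bh.
have -> : \int[P]_w (u (X 0 w) * (transition_op Q t h (X 0 w) - h (X 0 w))) =
    \int[Pi]_x (u x * (transition_op Q t h x - h x)).
  apply: (Rintegral_law (f := fun x => u x * (transition_op Q t h x - h x)) mX lawX) => //.
  by case: (bounded_measurableM bu bI).
rewrite -RintegralZl//; last by apply: square_integrable_mul;
  exact: bounded_measurable_square_integrable.
rewrite -RintegralD//; last 2 first.
- by apply: square_integrable_mul;
  [exact: bounded_measurable_square_integrable|exact: square_integrable_rest].
- by apply: square_integrable_mul => //; exact: bounded_measurable_square_integrable.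
by apply: eq_Rintegral => x _; rewrite /rest; ring.
Qed.

(** The quotient differs from the limit by the pairing of u with [rest h t], which Cauchy-Schwarz
    sends to 0. *)
Lemma lag_moment_derivative u h : bounded_measurable u -> core h ->
  t^-1 * (lag_moment u h t - lag_moment u h 0) @[t --> 0^'+] -->
  \int[Pi]_x (u x * G h x).
Proof.
move=> bu ch; have su := bounded_measurable_square_integrable bu.
rewrite -[X in _ --> X]add0r.
suff H : \int[Pi]_x (u x * rest h t x) @[t --> 0^'+] --> 0.
  apply: cvg_near_eq (cvgD H (cvg_cst (\int[Pi]_x (u x * G h x)))).
  near=> t => /=.
  by rewrite lag_moment_incr.
have H : l2norm Pi u * l2norm Pi (rest h t) @[t --> 0^'+] --> 0.
  by rewrite -[X in _ --> X](mulr0 (l2norm Pi u)); apply: cvgM;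
    [exact: cvg_cst|exact: cvg_rest].
apply/cvgr0Pnorm_le => e e0.
move/cvgr0_norm_le : H => /(_ e e0); apply: filterS => t.
rewrite ger0_norm ?mulr_ge0 ?l2norm_ge0//; apply: le_trans.
by apply: cauchy_schwarz => //; exact: square_integrable_rest.
Unshelve. all: by end_near. Qed.

(** Invariance of Pi: for u = 1 the lag moment is constant in t, so its derivative at 0 vanishes. *)
Lemma generator_mean0 h : core h -> \int[Pi]_x G h x = 0.
Proof.
move=> ch; have [_ bh _] := ch.
have b1 : bounded_measurable (cst 1 : 'rV[R]_k -> R) by exact: bounded_measurable_cst.
have := lag_moment_derivative b1 ch.
have -> : \int[Pi]_x (1 * G h x) = \int[Pi]_x G h x.
  by apply: eq_Rintegral => x _; rewrite mul1r.
move=> H; apply/esym; apply: (cvg_unique _ _ H) => //.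
apply: cvg_near_eq (cvg_cst 0); near=> t => /=.
have [mh _] := bh.
have E s : 0 <= s -> lag_moment (cst 1) h s = \int[Pi]_x h x.
  move=> s0; rewrite -(Rintegral_law mX lawX s0 mh).
  by apply: eq_Rintegral => w _; rewrite mul1r.
have t0 : 0 <= t by apply: ltW; near: t; exact: nbhs_right_gt.
by rewrite !E// subrr mulr0.
Unshelve. all: by end_near. Qed.

(* Telescoping over n steps of length t / n, with n going to infinity. *)
Lemma lag_moment_lipschitz u h t : 0 < t -> bounded_measurable u -> core h ->
  `|t^-1 * (lag_moment u h t - lag_moment u h 0)| <= l2norm Pi u * l2norm Pi (G h).
Proof.
move=> t0 bu ch; have [_ bh sG] := ch; have su := bounded_measurable_square_integrable bu.
(* Since X_s has law Pi, the bound for a step of length r does not depend on its starting time s. *)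
have step s r : 0 <= s -> 0 < r -> `|lag_moment u h (s + r) - lag_moment u h s| <=
    l2norm Pi u * (r * (l2norm Pi (rest h r) + l2norm Pi (G h))).
  move=> s0 r0; rewrite lag_momentS ?(ltW r0)//.
  have bI := bounded_measurable_incr r bh.
  apply: le_trans.
    apply: (cauchy_schwarz (f := fun w => u (X 0 w))
      (g := fun w => transition_op Q r h (X s w) - h (X s w))).
    - exact: (square_integrable_law mX lawX).
    - exact: (square_integrable_law mX lawX s0 (bounded_measurable_square_integrable bI)).
  rewrite (l2norm_law mX lawX (lexx 0) (proj1 bu)).
  rewrite (l2norm_law mX lawX s0 (proj1 bI)).
  apply: ler_wpM2l; first exact: l2norm_ge0.
  have -> : (fun x => transition_op Q r h x - h x) =
      (fun x => r * (rest h r x + G h x)).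
    by apply/funext => x; rewrite /rest; field; rewrite gt_eqF.
  rewrite l2normZ; last by apply: square_integrableD => //; exact: square_integrable_rest.
  by rewrite gtr0_norm// ler_pM2l// l2normD//; exact: square_integrable_rest.
have bound n : `|t^-1 * (lag_moment u h t - lag_moment u h 0)| <=
    l2norm Pi u * (l2norm Pi (rest h (t * n.+1%:R^-1)) + l2norm Pi (G h)).
  set r := t * n.+1%:R^-1; have r0 : 0 < r by rewrite mulr_gt0 ?invr_gt0.
  have tel m : `|lag_moment u h (m%:R * r) - lag_moment u h 0| <=
      m%:R * (l2norm Pi u * (r * (l2norm Pi (rest h r) + l2norm Pi (G h)))).
    elim: m => [|m IH]; first by rewrite !mul0r subrr normr0.
    have S := step (m%:R * r) r (mulr_ge0 (ler0n _ m) (ltW r0)) r0.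
    rewrite -natr1 !mulrDl !mul1r.
    have -> : lag_moment u h (m%:R * r + r) - lag_moment u h 0 =
      (lag_moment u h (m%:R * r) - lag_moment u h 0) +
      (lag_moment u h (m%:R * r + r) - lag_moment u h (m%:R * r)) by ring.
    by rewrite (le_trans (ler_normD _ _))// lerD.
  have := tel n.+1; have -> : n.+1%:R * r = t.
    by rewrite /r mulrCA divff ?mulr1// pnatr_eq0.
  rewrite normrM gtr0_norm ?invr_gt0// ler_pdivrMl// => /le_trans; apply.
  rewrite le_eqVlt; apply/orP; left; apply/eqP.
  have -> : t = n.+1%:R * r by rewrite /r mulrCA divff ?mulr1// pnatr_eq0.
  ring.
(* The generator is a limit from the right, so the step lengths must tend to 0 through positive
   values. *)
have cvg_step : t * n.+1%:R^-1 @[n --> \oo] --> 0^'+.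
  move=> A A0; have t_n : t * n.+1%:R^-1 @[n --> \oo] --> (0 : R).
    by rewrite -(mulr0 t); apply: cvgM; [exact: cvg_cst|exact: cvg_harmonic].
  have A0' : nbhs (0 : R) (fun y : R => 0 < y -> A y) by exact: A0.
  have [N _ AN] := t_n _ A0'; exists N => // n /= Nn; apply: AN => //.
  by rewrite /= mulr_gt0 ?invr_gt0.
have lim : l2norm Pi u * (l2norm Pi (rest h (t * n.+1%:R^-1)) + l2norm Pi (G h))
    @[n --> \oo] --> l2norm Pi u * (0 + l2norm Pi (G h)).
  apply: cvgM; first exact: cvg_cst.
  apply: cvgD; last exact: cvg_cst.
  exact: (cvg_comp (fun n => t * n.+1%:R^-1) (fun r => l2norm Pi (rest h r)) cvg_step
    (cvg_rest ch)).
by rewrite add0r in lim; apply: (ler_cvg_to (cvg_cst _) lim); exact: nearW.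
Qed.

(** * From core functions to a dominated limit *)

Variables (f g F H : 'rV[R]_k -> R) (f_ : nat -> 'rV[R]_k -> R).
Hypothesis core_f_ : forall n, core (f_ n).
(** The Lipschitz bound is applied to differences of approximants, so these must be core functions
    on which [G] is additive. *)
Hypothesis core_sub : forall m n, core (fun x => f_ m x - f_ n x).
Hypothesis G_sub : forall m n x,
  G (fun x => f_ m x - f_ n x) x = G (f_ m) x - G (f_ n) x.
Hypothesis cvg_f_ : forall x, f_ ^~ x @ \oo --> f x.
Hypothesis cvg_Gf_ : forall x, G (f_ n) x @[n --> \oo] --> g x.
Hypothesis sqiF : square_integrable Pi F.
Hypothesis sqiH : square_integrable Pi H.
Hypothesis f_F : forall n x, `|f_ n x| <= F x.
Hypothesis Gf_H : forall n x, `|G (f_ n) x| <= H x.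

Let mf_ n : measurable_fun setT (f_ n).
Proof. by have [_ []] := core_f_ n. Qed.

Let mGf_ n : measurable_fun setT (G (f_ n)).
Proof. by have [_ _ []] := core_f_ n. Qed.

Let quot u h t := t^-1 * (lag_moment u h t - lag_moment u h 0).

Let bmf_ n : bounded_measurable (f_ n). Proof. by case: (core_f_ n). Qed.

(** Error of replacing f by f_n in both arguments of the lag moment. It does not involve t, which is
    what permits the exchange of limits. *)
Let delta n := l2norm Pi f * l2norm Pi (fun x => g x - G (f_ n) x) +
  l2norm Pi (fun x => f x - f_ n x) * l2norm Pi (G (f_ n)).

Let cvg_delta : delta n @[n --> \oo] --> 0.
Proof.
have F0 x : 0 <= F x by exact: le_trans (f_F 0 x).
have H0 x : 0 <= H x by exact: le_trans (Gf_H 0 x).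
have fF x : `|f x| <= F x.
  by apply: (cvg_norm_le (@cvg_f_ x)) => n; exact: f_F.
have gH x : `|g x| <= H x.
  by apply: (cvg_norm_le (@cvg_Gf_ x)) => n; exact: Gf_H.
have mf : measurable_fun setT f by apply: (measurable_fun_cvg mf_) => x _; exact: cvg_f_.
have mg : measurable_fun setT g by apply: (measurable_fun_cvg mGf_) => x _; exact: cvg_Gf_.
have cf : l2norm Pi (fun x => f x - f_ n x) @[n --> \oo] --> 0.
  rewrite -(l2norm0 Pi); apply: dominated_cvg_l2norm (square_integrableD sqiF sqiF) _.
  - by move=> n; exact: measurable_funB.
  - move=> x; rewrite -[X in _ --> X](subrr (f x)).
    by apply: cvgB; [exact: cvg_cst|exact: cvg_f_].
  - by move=> n x; rewrite (le_trans (ler_normB _ _))// lerD.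
have cg : l2norm Pi (fun x => g x - G (f_ n) x) @[n --> \oo] --> 0.
  rewrite -(l2norm0 Pi); apply: dominated_cvg_l2norm (square_integrableD sqiH sqiH) _.
  - by move=> n; exact: measurable_funB.
  - move=> x; rewrite -[X in _ --> X](subrr (g x)).
    by apply: cvgB; [exact: cvg_cst|exact: cvg_Gf_].
  - by move=> n x; rewrite (le_trans (ler_normB _ _))// lerD.
have cG : l2norm Pi (G (f_ n)) @[n --> \oo] --> l2norm Pi g.
  exact: dominated_cvg_l2norm sqiH Gf_H.
have -> : 0 = l2norm Pi f * 0 + 0 * l2norm Pi g by rewrite mulr0 mul0r addr0.
by apply: cvgD; apply: cvgM => //; exact: cvg_cst.
Qed.

(** [f] need not be a core function, so [lag_moment_lipschitz] cannot be applied to f - f_n: f_m is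
    compared with f_n, and m goes to infinity at fixed t. *)
Let quot_close n t : 0 < t -> `|quot f f t - quot (f_ n) (f_ n) t| <= delta n.
Proof.
move=> t0.
have bound m : `|quot (f_ m) (f_ m) t - quot (f_ n) (f_ n) t| <=
    l2norm Pi (f_ m) * l2norm Pi (fun x => G (f_ m) x - G (f_ n) x) +
    l2norm Pi (fun x => f_ m x - f_ n x) * l2norm Pi (G (f_ n)).
  have bsub : bounded_measurable (fun x => f_ m x - f_ n x) by exact: bounded_measurableB.
  (* Polarisation: the generator will fall on the second argument, that is on f_m - f_n in one term
     and on f_n in the other. *)
  have -> : quot (f_ m) (f_ m) t - quot (f_ n) (f_ n) t =
      quot (f_ m) (fun x => f_ m x - f_ n x) t + quot (fun x => f_ m x - f_ n x) (f_ n) t.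
    rewrite /quot /lag_moment.
    under [X in _ = t^-1 * (X - _) + _]eq_Rintegral do rewrite mulrBr.
    under [X in _ = t^-1 * (_ - X) + _]eq_Rintegral do rewrite mulrBr.
    under [X in _ = _ + t^-1 * (X - _)]eq_Rintegral do rewrite mulrBl.
    under [X in _ = _ + t^-1 * (_ - X)]eq_Rintegral do rewrite mulrBl.
    have int u h s : 0 <= s -> bounded_measurable u -> bounded_measurable h ->
        P.-integrable setT (EFin \o (fun w => u (X 0 w) * h (X s w))).
      by move=> s0 bu bh; apply: bounded_measurable_integrable;
        apply: bounded_measurableM; exact: (bounded_measurable_law mX).
    rewrite !RintegralB//; try (by apply: int => //; exact: ltW).
    by ring.
  rewrite (le_trans (ler_normD _ _))// lerD//.
    have -> : (fun x => G (f_ m) x - G (f_ n) x) = G (fun x => f_ m x - f_ n x).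
      by apply/funext => x; rewrite G_sub.
    exact: lag_moment_lipschitz.
  exact: lag_moment_lipschitz.
have lag_cvg s : 0 <= s -> lag_moment (f_ m) (f_ m) s @[m --> \oo] --> lag_moment f f s.
  move=> s0; have [||||_ //] := @dominated_cvg_Rintegral _ _ _ P
    (fun m w => f_ m (X 0 w) * f_ m (X s w)) (fun w => f (X 0 w) * f (X s w))
    (fun w => F (X 0 w) * F (X s w)).
  - by move=> m; apply: measurable_funM; apply: measurableT_comp => //; exact: mX.
  - by move=> w; apply: cvgM; exact: cvg_f_.
  - by apply: square_integrable_mul; exact: (square_integrable_law mX lawX).
  - by move=> m w; rewrite normrM ler_pM.
have lhs : `|quot (f_ m) (f_ m) t - quot (f_ n) (f_ n) t| @[m --> \oo] -->
    `|quot f f t - quot (f_ n) (f_ n) t|.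
  apply: cvg_norm; apply: cvgB; last exact: cvg_cst.
  apply: cvgM; first exact: cvg_cst.
  by apply: cvgB; apply: lag_cvg => //; exact: ltW.
have rhs : l2norm Pi (f_ m) * l2norm Pi (fun x => G (f_ m) x - G (f_ n) x) +
    l2norm Pi (fun x => f_ m x - f_ n x) * l2norm Pi (G (f_ n)) @[m --> \oo] --> delta n.
  apply: cvgD; apply: cvgM; [| |  |exact: cvg_cst].
  - exact: dominated_cvg_l2norm sqiF f_F.
  - apply: dominated_cvg_l2norm (square_integrableD sqiH sqiH) _.
    + by move=> m; exact: measurable_funB.
    + by move=> x; apply: cvgB; [exact: cvg_Gf_|exact: cvg_cst].
    + by move=> m x; rewrite (le_trans (ler_normB _ _))// lerD.
  - apply: dominated_cvg_l2norm (square_integrableD sqiF sqiF) _.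
    + by move=> m; exact: measurable_funB.
    + by move=> x; apply: cvgB; [exact: cvg_f_|exact: cvg_cst].
    + by move=> m x; rewrite (le_trans (ler_normB _ _))// lerD.
by apply: (ler_cvg_to lhs rhs); exact: nearW.
Qed.

Lemma limit_lag_moment_derivative :
  t^-1 * (lag_moment f f t - lag_moment f f 0) @[t --> 0^'+] -->
  \int[Pi]_x (f x * g x).
Proof.
have [||||_ cfg] := @dominated_cvg_Rintegral _ _ _ Pi (fun n x => f_ n x * G (f_ n) x)
  (fun x => f x * g x) (fun x => F x * H x).
- by move=> n; exact: measurable_funM.
- by move=> x; apply: cvgM; [exact: cvg_f_|exact: cvg_Gf_].
- exact: square_integrable_mul.
- by move=> n x; rewrite normrM ler_pM.
apply/cvgrPdist_le => e e0.
have e3 : 0 < e / 3 by rewrite divr_gt0.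
(* The index n is fixed before t is sent to 0. *)
have [n [n1 n2]] : exists n, `|\int[Pi]_x (f x * g x) - \int[Pi]_x (f_ n x * G (f_ n) x)|
  <= e / 3
    /\ delta n <= e / 3.
  have /cvgrPdist_le/(_ _ e3) N1 := cfg.
  have /cvgr0_norm_le/(_ _ e3) N2 := cvg_delta.
  have [n _ Hn] := filterI N1 N2; exists n.
  have [] := Hn n (leqnn n); split => //.
  by apply: le_trans (ler_norm _) _.
have /cvgrPdist_le/(_ _ e3) N3 := lag_moment_derivative (bmf_ n) (core_f_ n).
near=> t.
have t0 : 0 < t by near: t; exact: nbhs_right_gt.
have := quot_close n t0.
have : `|\int[Pi]_x (f_ n x * G (f_ n) x) - quot (f_ n) (f_ n) t| <= e / 3.
  by near: t; exact: N3.
move: n1 n2; rewrite -/(quot f f t) !ler_norml; lra.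
Unshelve. all: by end_near. Qed.

End generator_estimates.

(** * C^2 functions of several variables *)

Section derivatives.
Context {R : realType}.

Lemma cvg_is_derive (V W : normedModType R) (f : V -> W) x v df :
  h^-1 *: (f (h *: v + x) - f x) @[h --> 0^'] --> df -> is_derive x v f df.
Proof.
move=> H; apply: DeriveDef; first exact: (cvgP _ H).
exact: (cvg_lim _ H).
Qed.

Lemma is_derive_line (V W : normedModType R) (f : V -> W) x v df :
  is_derive x v f df -> is_derive (0 : R) 1 (fun h => f (h *: v + x)) df.
Proof.
move=> [/derivableP [D _] <-]; apply: cvg_is_derive.
apply: cvg_near_eq D; apply: nearW => h /=.
by rewrite addr0 scale0r add0r [_%:A]mulr1.
Qed.

(** A directional derivative does not make [f] differentiable at x; the chain rule is applied on the
    line h -> f (h v + x), where derivable and differentiable agree. *)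
Lemma is_derive_chain (V : normedModType R) (f : V -> R) (psi : R -> R) x v df dpsi :
  is_derive x v f df -> is_derive (f x) 1 psi dpsi ->
  is_derive x v (fun y => psi (f y)) (dpsi * df).
Proof.
move=> Df Dpsi.
have DF := is_derive_line Df; set F := (fun h : R => f (h *: v + x)) in DF.
have F0 : F 0 = f x by rewrite /F scale0r add0r.
have DpsiF : is_derive (0 : R) 1 (psi \o F) (dpsi * df).
  have [Dp vp] := Dpsi; have [DF1 vF] := DF.
  apply: DeriveDef.
    apply/derivable1_diffP; apply: differentiable_comp.
      exact/derivable1_diffP.
    by apply/derivable1_diffP; rewrite F0.
  by rewrite -derive1E derive1_comp// ?F0// !derive1E vp vF.
have [D1 D2] := DpsiF.
apply: cvg_is_derive; have := D1; rewrite /derivable => /cvg_ex[l Hl].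
have El : l = dpsi * df by rewrite -D2; apply/esym; exact: (cvg_lim _ Hl).
rewrite -El; apply: cvg_near_eq Hl; apply: nearW => h /=.
by rewrite /F addr0 scale0r add0r [_%:A]mulr1.
Qed.

Definition pos_pow n (t : R) : R := Num.max 0 t ^+ n.

Lemma continuous_pos_pow n : continuous (pos_pow n).
Proof.
move=> t; apply: (@continuous_comp _ _ _ (fun t : R => Num.max 0 t) (fun y => y ^+ n)).
  by apply: continuous_max => //; exact: cst_continuous.
exact: exprn_continuous.
Qed.

Lemma pos_pow_ge0 n t : 0 <= pos_pow n t.
Proof. by apply: exprn_ge0; rewrite le_max lexx. Qed.

Lemma pos_pow_le1 n t : t <= 1 -> pos_pow n t <= 1.
Proof. by move=> t1; apply: exprn_ile1; rewrite ?le_max ?lexx// ge_max ler01. Qed.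

(** At the kink t = 0 the quotient is h^(n+1) for h > 0 and 0 for h < 0; it tends to 0 because the
    power n+2 is at least 2. *)
Lemma is_derive_pos_pow n (t : R) :
  is_derive t 1 (pos_pow n.+2) (n.+2%:R * pos_pow n.+1 t).
Proof.
have [t0|t0|t0] := ltgtP t 0.
- have -> : n.+2%:R * pos_pow n.+1 t = 0.
    by rewrite /pos_pow (max_idPl (ltW t0)) expr0n mulr0.
  have D0 : is_derive t 1 (cst 0 : R -> R) 0 by exact: is_derive_cst.
  apply: near_eq_is_derive D0; near=> y; rewrite /pos_pow (max_idPl _) ?expr0n//.
  by apply: ltW; near: y; exact: lt_nbhsl.
- have Dn : is_derive t 1 (fun y : R => y ^+ n.+2) (n.+2%:R * pos_pow n.+1 t).
    have -> : (fun y : R => y ^+ n.+2) = id ^+ n.+2 by apply/funext => y; rewrite exprfctE.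
    apply: is_derive_eq.
    by rewrite /pos_pow (max_idPr (ltW t0)) [_ *: _]mulr1.
  apply: near_eq_is_derive Dn; near=> y; rewrite /pos_pow (max_idPr _)//.
  by apply: ltW; near: y; exact: lt_nbhsr.
- have P0 m : pos_pow m.+1 0 = 0 by rewrite /pos_pow maxxx expr0n.
  rewrite t0 P0 mulr0.
  apply: cvg_is_derive.
  apply/cvgr0Pnorm_le => e e0; near=> h.
  have hn0 : h != 0 by near: h; exact: nbhs_dnbhs_neq.
  rewrite P0 subr0 addr0 [h *: 1]mulr1 /pos_pow.
  have [h0|h0] := leP h 0; first by rewrite expr0n/= scaler0 normr0 ltW.
  have he : `|h| <= Num.min 1 e.
    near: h; apply: dnbhs0_le; by rewrite lt_min ltr01 e0.
  move: he; rewrite le_min => /andP[h1 he].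
  rewrite exprS scalerA mulVf// scale1r normrX exprS.
  rewrite -[leRHS]mulr1 ler_pM// ?exprn_ge0// exprn_ile1//.
Unshelve. all: by end_near. Qed.

End derivatives.

(** * Functions carried with explicit gradient and Hessian *)

Section jets.
Context {R : realType} {k : nat}.
Notation V := 'rV[R]_k.
Notation e_ i := (delta_mx 0 i : V).
Implicit Types (f : V -> R) (g : 'I_k -> V -> R) (H : 'I_k -> 'I_k -> V -> R).

(** Carrying the derivatives along means that each algebraic construction yields at once the
    regularity [C2] and the value of the generator. The index order is that of [hessian]. *)
Definition jet f g H : Prop :=
  [/\ continuous f, forall i x, is_derive x (e_ i) f (g i x),
      forall i, continuous (g i),
      forall i j x, is_derive x (e_ i) (g j) (H i j x) &
      forall i j, continuous (H i j)].

Lemma jet_eq f g H f' g' H' : jet f g H -> (forall x, f x = f' x) ->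
  (forall i x, g i x = g' i x) -> (forall i j x, H i j x = H' i j x) -> jet f' g' H'.
Proof.
move=> J fE gE HE.
have -> : f' = f by apply/funext => x; rewrite fE.
have -> : g' = g by apply/funext => i; apply/funext => x; rewrite gE.
by have -> : H' = H by apply/funext => i; apply/funext => j; apply/funext => x; rewrite HE.
Qed.

Lemma jet_partial f g H i : jet f g H -> partial i f = g i.
Proof. by move=> [_ D _ _ _]; apply/funext => x; have [_] := D i x. Qed.

Lemma jet_partial2 f g H i j : jet f g H -> partial i (partial j f) = H i j.
Proof.
move=> J; rewrite (jet_partial _ J); have [_ _ _ D _] := J.
by apply/funext => x; have [_] := D i j x.
Qed.

Lemma jet_C2 f g H : jet f g H -> C2 f.
Proof.
move=> J; have [cf Df cg Dg cH] := J; split=> [i|j i].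
  by rewrite (jet_partial _ J); split => // x; have [] := Df i x.
rewrite (jet_partial2 _ _ J) (jet_partial _ J); split=> [x|]; last exact: cH.
by have [] := Dg i j x.
Qed.

Lemma jet_cst c : jet (cst c) (fun _ => cst 0) (fun _ _ => cst 0).
Proof.
split=> [|i x|i|i j x|i j]; by [exact: cst_continuous|exact: is_derive_cst].
Qed.

Lemma dotE (v x : V) : (v *m x^T) 0 0 = \sum_j v 0 j * x 0 j.
Proof. by rewrite mxE; apply: eq_bigr => i _; rewrite mxE. Qed.

Lemma continuous_sum (I : Type) (s : seq I) (f_ : I -> V -> R) :
  (forall i, continuous (f_ i)) -> continuous (fun x => \sum_(i <- s) f_ i x).
Proof.
move=> cf; elim: s => [|i s IH].
  by under eq_fun do rewrite big_nil; exact: cst_continuous.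
by under eq_fun do rewrite big_cons; move=> x; exact: (cvgD (cf i x) (IH x)).
Qed.

Lemma jet_linear_form (v : V) :
  jet (fun x => (v *m x^T) 0 0) (fun i => cst (v 0 i)) (fun _ _ => cst 0).
Proof.
split=> [|i x|i|i j x|i j]; try exact: cst_continuous; last exact: is_derive_cst.
  under eq_fun do rewrite dotE.
  apply: continuous_sum => i x.
  exact: (cvgM (cvg_cst (v 0 i)) (@coord_continuous _ _ _ 0 i x)).
apply: cvg_is_derive; apply: cvg_near_eq (cvg_cst (v 0 i)).
near=> h; have hn0 : h != 0 by near: h; exact: nbhs_dnbhs_neq.
rewrite /= !dotE -sumrB (bigD1 i)//= big1 ?addr0.
  rewrite !mxE !eqxx mulr1 -mulrBr addrK /GRing.scale/=.
  by rewrite mulrCA mulVf ?mulr1.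
by move=> l li; rewrite !mxE eqxx (negbTE li) mulr0 add0r subrr.
Unshelve. all: by end_near. Qed.

Lemma jetD f1 g1 H1 f2 g2 H2 : jet f1 g1 H1 -> jet f2 g2 H2 ->
  jet (fun x => f1 x + f2 x) (fun i x => g1 i x + g2 i x)
    (fun i j x => H1 i j x + H2 i j x).
Proof.
move=> [cf1 Df1 cg1 Dg1 cH1] [cf2 Df2 cg2 Dg2 cH2]; split.
- by move=> x; exact: (cvgD (cf1 x) (cf2 x)).
- by move=> i x; apply: is_deriveD.
- by move=> i x; exact: (cvgD (cg1 i x) (cg2 i x)).
- by move=> i j x; apply: is_deriveD.
- by move=> i j x; exact: (cvgD (cH1 i j x) (cH2 i j x)).
Qed.

Lemma jetM f1 g1 H1 f2 g2 H2 : jet f1 g1 H1 -> jet f2 g2 H2 ->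
  jet (fun x => f1 x * f2 x) (fun i x => f1 x * g2 i x + f2 x * g1 i x)
    (fun i j x => f1 x * H2 i j x + f2 x * H1 i j x +
                  (g1 i x * g2 j x + g2 i x * g1 j x)).
Proof.
move=> [cf1 Df1 cg1 Dg1 cH1] [cf2 Df2 cg2 Dg2 cH2]; split.
- by move=> x; exact: (cvgM (cf1 x) (cf2 x)).
- by move=> i x; exact: is_deriveM.
- move=> i x.
  exact: (cvgD (cvgM (cf1 x) (cg2 i x)) (cvgM (cf2 x) (cg1 i x))).
- move=> i j x; apply: is_derive_eq.
  by rewrite /GRing.scale/=; ring.
- move=> i j x.
  exact: (cvgD (cvgD (cvgM (cf1 x) (cH2 i j x)) (cvgM (cf2 x) (cH1 i j x)))
    (cvgD (cvgM (cg1 i x) (cg2 j x)) (cvgM (cg2 i x) (cg1 j x)))).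
Qed.

Lemma jetZ c f g H : jet f g H ->
  jet (fun x => c * f x) (fun i x => c * g i x) (fun i j x => c * H i j x).
Proof.
by move=> J; apply: jet_eq (jetM (jet_cst c) J) _ _ _ => * /=; ring.
Qed.

Lemma jetB f1 g1 H1 f2 g2 H2 : jet f1 g1 H1 -> jet f2 g2 H2 ->
  jet (fun x => f1 x - f2 x) (fun i x => g1 i x - g2 i x)
    (fun i j x => H1 i j x - H2 i j x).
Proof.
by move=> J1 J2; apply: jet_eq (jetD J1 (jetZ (-1) J2)) _ _ _ => * /=; ring.
Qed.

Lemma jet_sum (f_ : 'I_k -> V -> R) (g_ : 'I_k -> 'I_k -> V -> R)
    (H_ : 'I_k -> 'I_k -> 'I_k -> V -> R) :
  (forall l, jet (f_ l) (g_ l) (H_ l)) ->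
  jet (fun x => \sum_l f_ l x) (fun i x => \sum_l g_ l i x)
    (fun i j x => \sum_l H_ l i j x).
Proof.
move=> J; elim: (index_enum _) => [|l s IH].
  by apply: jet_eq (jet_cst 0) _ _ _ => *; rewrite big_nil.
by apply: jet_eq (jetD (J l) IH) _ _ _ => *; rewrite big_cons.
Qed.

Lemma jet_comp f g H (psi dpsi ddpsi : R -> R) : jet f g H ->
  (forall t : R, is_derive t 1 psi (dpsi t)) ->
  (forall t : R, is_derive t 1 dpsi (ddpsi t)) -> continuous ddpsi ->
  jet (fun x => psi (f x)) (fun i x => dpsi (f x) * g i x)
    (fun i j x => ddpsi (f x) * g i x * g j x + dpsi (f x) * H i j x).
Proof.
move=> [cf Df cg Dg cH] D1 D2 c2.
have cont (h dh : R -> R) : (forall t : R, is_derive t 1 h (dh t)) -> continuous h.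
  move=> Dh t; apply/differentiable_continuous/derivable1_diffP.
  by have [] := Dh t.
have c0 := cont _ _ D1; have c1 := cont _ _ D2.
have ccomp (h : R -> R) : continuous h -> continuous (fun x => h (f x)).
  by move=> ch x; apply: continuous_comp; [exact: cf|exact: ch].
split.
- exact: ccomp.
- by move=> i x; exact: is_derive_chain.
- by move=> i x; exact: (cvgM (ccomp _ c1 x) (cg i x)).
- move=> i j x; apply: is_derive_eq.
    by apply: (@is_deriveM _ _ (fun x => dpsi (f x)) (g j)); exact: is_derive_chain.
  by rewrite /GRing.scale/=; ring.
- move=> i j x.
  exact: (cvgD (cvgM (cvgM (ccomp _ c2 x) (cg i x)) (cg j x))
    (cvgM (ccomp _ c1 x) (cH i j x))).
Qed.

(** The norm of ['rV] is the sup norm; a smooth cutoff needs the Euclidean square instead. *)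
Definition normsq (x : V) : R := \sum_l x 0 l ^+ 2.

Lemma jet_normsq : jet normsq (fun i x => 2 * x 0 i) (fun i j => cst (2 * (i == j)%:R)).
Proof.
have J l := jetM (jet_linear_form (e_ l)) (jet_linear_form (e_ l)).
have E l (x : V) : (e_ l *m x^T) 0 0 = x 0 l.
  rewrite mxE (bigD1 l)//= big1 ?addr0 ?mxE ?eqxx ?mul1r// => i il.
  by rewrite !mxE (negbTE il) mul0r.
apply: jet_eq (jet_sum J) _ _ _ => [x|i x|i j x] /=.
- by apply: eq_bigr => l _; rewrite !E expr2.
- rewrite (bigD1 i)//= big1 ?addr0; last first.
    move=> l li /=; have -> : (e_ l : V) 0 i = 0 by rewrite mxE eqxx eq_sym (negbTE li).
    by rewrite !mulr0 addr0.
  have -> : (e_ i : V) 0 i = 1 by rewrite mxE !eqxx.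
  by rewrite E mulr1 -mulr2n mulr_natl.
- rewrite (bigD1 i)//= big1 ?addr0; last first.
    by move=> l li; rewrite !mxE [i == l]eq_sym (negbTE li) !mulr0 !mul0r !add0r.
  by rewrite !mxE !eqxx !mulr0 !add0r [j == i]eq_sym /=; ring.
Qed.

Lemma normsq_ge0 x : 0 <= normsq x.
Proof. by apply: sumr_ge0 => i _; exact: sqr_ge0. Qed.

Lemma coord_le_normsq (x : V) i : x 0 i ^+ 2 <= normsq x.
Proof.
by rewrite /normsq (bigD1 i)//= lerDl; apply: sumr_ge0 => j _; exact: sqr_ge0.
Qed.

Lemma compact_normsq_le (M : R) : compact [set x : V | normsq x <= M].
Proof.
have [cn _ _ _ _] := jet_normsq.
apply: bounded_closed_compact; last first.
  rewrite (_ : [set x | _] = normsq @^-1` [set t | t <= M])//.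
  by apply: preimage_closed => //; exact: closed_le.
exists (`|M| + 1); split; first exact: num_real.
move=> N MN x /= xM.
rewrite /Num.norm/= mx_normrE; apply/bigmax_leP; split.
  by rewrite (le_trans _ (ltW MN))// addr_ge0.
move=> [i j] _ /=; rewrite (ord1 i).
have [//|Nx] := leP `|x 0 j| N.
have := coord_le_normsq x j; rewrite -(real_normK (num_real (x 0 j))).
have := ler_norm M; have := normr_ge0 M; nra.
Qed.

Lemma compact_support_normsq f (M : R) : (forall x, M <= normsq x -> f x = 0) ->
  compact (closure [set x | f x != 0]).
Proof.
move=> fM; have cM := @compact_normsq_le M.
have cl : closed [set x : V | normsq x <= M].
  by apply: compact_closed => //; exact: norm_hausdorff.
apply: (subclosed_compact (@closed_closure _ _) cM).
move/closure_id : cl => clE; rewrite [X in _ `<=` X]clE; apply: closureS => x /= /eqP fx.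
by have [//|/ltW /fM] := leP (normsq x) M.
Qed.

Lemma bounded_vanishing f (M : R) : continuous f ->
  (forall x, M <= normsq x -> f x = 0) -> exists B, forall x, `|f x| <= B.
Proof.
move=> cf fM; have cM := @compact_normsq_le M.
have /compact_bounded [N [_ HN]] : compact (f @` [set x | normsq x <= M]).
  by apply: continuous_compact => //; exact: continuous_subspaceT.
exists (`|N| + 1) => x; have [xM|/ltW /fM ->] := leP (normsq x) M.
  by apply: HN; [rewrite (le_lt_trans (ler_norm N))// ltrDl|exists x].
by rewrite normr0 addr_ge0.
Qed.

End jets.

(** * Cutoffs and second-order operators *)

Section cutoff.
Context {R : realType} {k : nat}.
Notation V := 'rV[R]_k.
Implicit Types (n : nat) (x : V) (i j l : 'I_k).

Let eps n : R := n.+1%:R^-1.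

Let eps01 n : 0 < eps n <= 1.
Proof. by rewrite invr_gt0 ltr0n/= invf_le1// ler1n. Qed.

Let arg n x : R := 1 - eps n * normsq x.

(** The cube is the least integer power of a positive part that is C^2. *)
Definition cutoff n x : R := pos_pow 3 (arg n x).

Definition cutoff_grad n i x : R := 3 * pos_pow 2 (arg n x) * - (eps n * (2 * x 0 i)).

Definition cutoff_hess n i j x : R :=
  6 * pos_pow 1 (arg n x) * (eps n * (2 * x 0 i)) * (eps n * (2 * x 0 j)) +
  3 * pos_pow 2 (arg n x) * - (eps n * (2 * (i == j)%:R)).

Lemma jet_cutoff n : jet (cutoff n) (cutoff_grad n) (cutoff_hess n).
Proof.
have J := jetB (jet_cst 1) (jetZ (eps n) (@jet_normsq R k)).
have D1 (t : R) : is_derive t 1 (pos_pow 3) (3 * pos_pow 2 t) by exact: is_derive_pos_pow.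
have D2 (t : R) : is_derive t 1 (fun t => 3 * pos_pow 2 t) (6 * pos_pow 1 t).
  have -> : (fun t : R => 3 * pos_pow 2 t) = 3 \*: pos_pow 2 by [].
  apply: is_derive_eq; first by apply: is_deriveZ; exact: is_derive_pos_pow.
  by rewrite /GRing.scale/= mulrA -natrM.
have c2 : continuous (fun t : R => 6 * pos_pow 1 t).
  by move=> t; apply: cvgM; [exact: cvg_cst|exact: continuous_pos_pow].
apply: jet_eq (jet_comp J D1 D2 c2) _ _ _ => [x|i x|i j x] //=.
- by rewrite /cutoff_grad /arg /=; ring.
- by rewrite /cutoff_hess /arg /=; ring.
Qed.

Let arg_le1 n x : arg n x <= 1.
Proof.
have /andP[e0 _] := eps01 n.
by rewrite gerBl mulr_ge0 ?normsq_ge0// ltW.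
Qed.

Let pos01 n m x : 0 <= pos_pow m (arg n x) <= 1.
Proof. by rewrite pos_pow_ge0 pos_pow_le1. Qed.

(** Either all powers occurring in the cutoff and its derivatives vanish, or the coordinates are
    controlled by [eps n]. The successor is essential: [pos_pow 0] is 1 everywhere. *)
Let arg_cases n x : (forall m, pos_pow m.+1 (arg n x) = 0) \/ eps n * normsq x <= 1.
Proof.
have [h|h] := leP (arg n x) 0; [left|right].
  by move=> m; rewrite /pos_pow (max_idPl h) expr0n.
by move: h; rewrite subr_gt0 => /ltW.
Qed.

Let eps_coord n x i : eps n * normsq x <= 1 -> `|eps n * x 0 i| <= 1.
Proof.
move=> h; have /andP[e0 e1] := eps01 n.
have q : eps n * x 0 i ^+ 2 <= 1.
  by apply: le_trans h; rewrite ler_pM2l// coord_le_normsq.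
rewrite -(@ler_pXn2r _ 2) ?nnegrE// expr1n real_normK ?num_real// exprMn expr2 -mulrA.
by apply: mulr_ile1 => //; [exact: ltW|rewrite mulr_ge0 ?sqr_ge0// ltW].
Qed.

Let eps_coord2 n x i j : eps n * normsq x <= 1 -> `|eps n * x 0 i * x 0 j| <= 1.
Proof.
move=> h; have /andP[e0 e1] := eps01 n.
have q l : eps n * x 0 l ^+ 2 <= 1.
  by apply: le_trans h; rewrite ler_pM2l// coord_le_normsq.
have := q i; have := q j; rewrite ler_norml.
(* The squares of x_i - x_j and x_i + x_j bound the product x_i x_j from both sides. *)
have := mulr_ge0 (ltW e0) (sqr_ge0 (x 0 i - x 0 j)).
have := mulr_ge0 (ltW e0) (sqr_ge0 (x 0 i + x 0 j)).
nra.
Qed.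

Lemma cutoff_bound n x : 0 <= cutoff n x <= 1.
Proof. exact: pos01. Qed.

Lemma cutoff_grad_bound n i x : `|cutoff_grad n i x| <= 6.
Proof.
rewrite /cutoff_grad; have [->|h] := arg_cases n x.
  by rewrite mulr0 mul0r normr0.
have := eps_coord i h; have /andP[] := pos01 n 2 x.
set a := pos_pow 2 _; set b := eps n * _ => a0 a1 b1.
have -> : 3 * a * - (eps n * (2 * x 0 i)) = - (6 * (a * b)) by rewrite /b; ring.
rewrite normrN normrM (ger0_norm (ler0n _ 6)) -[leRHS]mulr1 ler_pM// normrM.
by rewrite mulr_ile1// ger0_norm.
Qed.

(** The gradient is of order |x| / (n+1) and lives where |x|^2 <= n+1, so one more factor |x| keeps
    it bounded uniformly in n. This absorbs the linear growth of the score. *)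
Lemma cutoff_grad_coord_bound n i j x : `|x 0 j * cutoff_grad n i x| <= 6.
Proof.
rewrite /cutoff_grad; have [->|h] := arg_cases n x.
  by rewrite mulr0 mul0r mulr0 normr0.
have := eps_coord2 i j h; have /andP[] := pos01 n 2 x.
set a := pos_pow 2 _; set b := eps n * _ * _ => a0 a1 b1.
have -> : x 0 j * (3 * a * - (eps n * (2 * x 0 i))) = - (6 * (a * b)) by rewrite /b; ring.
rewrite normrN normrM (ger0_norm (ler0n _ 6)) -[leRHS]mulr1 ler_pM// normrM.
by rewrite mulr_ile1// ger0_norm.
Qed.

Lemma cutoff_hess_bound n i j x : `|cutoff_hess n i j x| <= 30.
Proof.
rewrite /cutoff_hess; have /andP[e0 e1] := eps01 n.
have [h0|h] := arg_cases n x.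
  by rewrite !h0 !mulr0 !mul0r addr0 normr0.
have := eps_coord i h; have := eps_coord j h.
have /andP[] := pos01 n 2 x; have /andP[] := pos01 n 1 x.
set a := pos_pow 1 _; set b := pos_pow 2 _ => a0 a1 b0 b1.
set y := eps n * x 0 i; set z := eps n * x 0 j => z1 y1.
have -> : 6 * a * (eps n * (2 * x 0 i)) * (eps n * (2 * x 0 j)) +
    3 * b * - (eps n * (2 * (i == j)%:R)) =
    24 * (a * (y * z)) - 6 * (b * (eps n * (i == j)%:R)) by rewrite /y /z; ring.
have t1 : `|a * (y * z)| <= 1.
  by rewrite normrM mulr_ile1// ?(ger0_norm a0)// normrM mulr_ile1.
have t2 : `|b * (eps n * (i == j)%:R)| <= 1.
  rewrite normrM mulr_ile1// ?(ger0_norm b0)// normrM (gtr0_norm e0).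
  by rewrite mulr_ile1// ?(ltW e0)//; case: (_ == _); rewrite ?normr1 ?normr0.
by move: t1 t2; rewrite !ler_norml; lra.
Qed.

Lemma cutoff_support n x : n.+1%:R <= normsq x ->
  [/\ cutoff n x = 0, forall i, cutoff_grad n i x = 0 &
      forall i j, cutoff_hess n i j x = 0].
Proof.
move=> nx; have a0 : arg n x <= 0.
  by rewrite subr_le0 /eps mulrC ler_pdivlMr ?ltr0n// mul1r.
have p0 m : pos_pow m.+1 (arg n x) = 0 by rewrite /pos_pow (max_idPl a0) expr0n.
by split=> *; rewrite /cutoff /cutoff_grad /cutoff_hess !p0 ?mulr0 ?mul0r ?addr0.
Qed.

Let cvg_eps : eps n @[n --> \oo] --> 0.
Proof. exact: cvg_harmonic. Qed.

Let cvg_pos m x : pos_pow m (arg n x) @[n --> \oo] --> (1 : R).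
Proof.
have <- : pos_pow m (1 - 0 * normsq x) = 1.
  by rewrite mul0r subr0 /pos_pow (max_idPr ler01) expr1n.
apply: continuous_cvg; first exact: continuous_pos_pow.
by apply: cvgB; [exact: cvg_cst|apply: cvgM => //; exact: cvg_cst].
Qed.

Lemma cvg_cutoff x : cutoff n x @[n --> \oo] --> (1 : R).
Proof. exact: cvg_pos. Qed.

Lemma cvg_cutoff_grad i x : cutoff_grad n i x @[n --> \oo] --> (0 : R).
Proof.
have <- : 3 * 1 * - (0 * (2 * x 0 i)) = 0 by ring.
apply: cvgM; first by apply: cvgM; [exact: cvg_cst|exact: cvg_pos].
by apply: cvgN; apply: cvgM => //; exact: cvg_cst.
Qed.

Lemma cvg_cutoff_hess i j x : cutoff_hess n i j x @[n --> \oo] --> (0 : R).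
Proof.
have <- : 6 * 1 * (0 * (2 * x 0 i)) * (0 * (2 * x 0 j)) +
    3 * 1 * - (0 * (2 * (i == j)%:R)) = 0 by ring.
apply: cvgD.
  apply: cvgM; last by apply: cvgM => //; exact: cvg_cst.
  apply: cvgM; last by apply: cvgM => //; exact: cvg_cst.
  by apply: cvgM; [exact: cvg_cst|exact: cvg_pos].
apply: cvgM; first by apply: cvgM; [exact: cvg_cst|exact: cvg_pos].
by apply: cvgN; apply: cvgM => //; exact: cvg_cst.
Qed.

Let mcoord i : measurable_fun setT (fun x : V => x 0 i).
Proof. exact: measurable_coord. Qed.

Let measurable_pos m n : measurable_fun setT (fun x => pos_pow m (arg n x)).
Proof.
apply: measurable_funX; apply: measurable_maxr => //.
apply: measurable_funB => //; apply: measurable_funM => //.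
by apply: measurable_sum => l; exact: measurable_funX.
Qed.

Lemma measurable_cutoff n : measurable_fun setT (cutoff n).
Proof. exact: measurable_pos. Qed.

Lemma measurable_cutoff_grad n i : measurable_fun setT (cutoff_grad n i).
Proof.
apply: measurable_funM; first exact: measurable_funM.
by apply: measurableT_comp => //; do 2 apply: measurable_funM => //.
Qed.

Lemma measurable_cutoff_hess n i j : measurable_fun setT (cutoff_hess n i j).
Proof.
apply: measurable_funD.
  apply: measurable_funM; last by do 2 apply: measurable_funM => //.
  apply: measurable_funM; last by do 2 apply: measurable_funM => //.
  exact: measurable_funM.
by apply: measurable_funM => //; exact: measurable_funM.
Qed.

End cutoff.

(** * Second-order operators and truncation *)

Section second_order_operator.
Context {R : realType} {k : nat}.
Notation V := 'rV[R]_k.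
Variables (A : 'M[R]_k) (s : 'I_k -> V -> R) (S : R).
Hypothesis S0 : 0 <= S.
Hypothesis s_growth : forall i x, `|s i x| <= S * (1 + \sum_l `|x 0 l|).
Implicit Types (f : V -> R) (g : 'I_k -> V -> R) (H : 'I_k -> 'I_k -> V -> R).

Definition diffusion_op g H (x : V) : R := \sum_i \sum_j A i j * (H i j x + s i x * g j x).

(** The product rule; for symmetric [A] the last sum is twice the carre du champ of the two
    functions. It serves both for the truncations and for the square of an observable. *)
Lemma diffusion_op_prod f g H f' g' H' x :
  diffusion_op (fun i x => f x * g' i x + f' x * g i x)
    (fun i j x => f x * H' i j x + f' x * H i j x + (g i x * g' j x + g' i x * g j x)) x =
  f x * diffusion_op g' H' x + f' x * diffusion_op g H x +
  \sum_i \sum_j A i j * (g i x * g' j x + g' i x * g j x).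
Proof.
rewrite /diffusion_op !big_distrr/= -!big_split/=; apply: eq_bigr => i _.
rewrite !big_distrr/= -!big_split/=; apply: eq_bigr => j _; ring.
Qed.

Lemma diffusion_opB g H g' H' x :
  diffusion_op (fun i x => g i x - g' i x) (fun i j x => H i j x - H' i j x) x =
  diffusion_op g H x - diffusion_op g' H' x.
Proof.
rewrite /diffusion_op -sumrB; apply: eq_bigr => i _; rewrite -sumrB; apply: eq_bigr => j _.
ring.
Qed.

Lemma diffusion_op_eq0 g H x : (forall i, g i x = 0) -> (forall i j, H i j x = 0) ->
  diffusion_op g H x = 0.
Proof.
move=> g0 H0; rewrite /diffusion_op big1// => i _; rewrite big1// => j _.
by rewrite g0 H0; ring.
Qed.

Lemma measurable_diffusion_op g H : (forall i, measurable_fun setT (s i)) ->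
  (forall i, measurable_fun setT (g i)) -> (forall i j, measurable_fun setT (H i j)) ->
  measurable_fun setT (diffusion_op g H).
Proof.
move=> ms mg mH; apply: measurable_sum => i; apply: measurable_sum => j.
apply: measurable_funM => //; apply: measurable_funD => //; exact: measurable_funM.
Qed.

Lemma continuous_diffusion_op g H : (forall i, continuous (s i)) ->
  (forall i, continuous (g i)) -> (forall i j, continuous (H i j)) ->
  continuous (diffusion_op g H).
Proof.
move=> cs cg cH; apply: continuous_sum => i; apply: continuous_sum => j x.
exact: (cvgM (cvg_cst (A i j)) (cvgD (cH i j x) (cvgM (cs i x) (cg j x)))).
Qed.

Let bound_A := \sum_i \sum_j `|A i j|.

Let ler_sumA (F : 'I_k -> 'I_k -> R) (B : R) : (forall i j, `|F i j| <= B) ->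
  `|\sum_i \sum_j A i j * F i j| <= bound_A * B.
Proof.
move=> FB; rewrite /bound_A big_distrl/=.
apply: (le_trans (ler_norm_sum _ _ _)); apply: ler_sum => i _.
rewrite big_distrl/=; apply: (le_trans (ler_norm_sum _ _ _)); apply: ler_sum => j _.
by rewrite normrM ler_wpM2l.
Qed.

(** Uniform in n and x: 30 bounds the Hessian, and 6 + 6 k bounds the gradient multiplied by 1 +
    sum_l |x_l|. *)
Lemma diffusion_op_cutoff_bound n x :
  `|diffusion_op (cutoff_grad n) (cutoff_hess n) x| <= bound_A * (30 + S * (6 + k%:R * 6)).
Proof.
apply: ler_sumA => i j; apply: (le_trans (ler_normD _ _)).
apply: lerD; first exact: cutoff_hess_bound.
rewrite normrM; apply: (@le_trans _ _
  (S * (1 + \sum_l `|x 0 l|) * `|cutoff_grad n j x|)); first exact: ler_wpM2r.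
rewrite -mulrA ler_wpM2l// mulrDl mul1r lerD ?cutoff_grad_bound//.
rewrite big_distrl/= -[k in leRHS]card_ord -sum1_card natr_sum big_distrl/=.
by apply: ler_sum => l _; rewrite mul1r -normrM cutoff_grad_coord_bound.
Qed.

Definition cut_grad f g n : 'I_k -> V -> R :=
  fun i x => f x * cutoff_grad n i x + cutoff n x * g i x.

Definition cut_hess f g H n : 'I_k -> 'I_k -> V -> R :=
  fun i j x => f x * cutoff_hess n i j x + cutoff n x * H i j x +
    (g i x * cutoff_grad n j x + cutoff_grad n i x * g j x).

(** Provides the dominating function for the generator of all truncations of f at once. The 12 comes
    from the two cross terms, each with a cutoff gradient of size at most 6. *)
Lemma diffusion_op_cut_bound : exists2 C, 0 <= C & forall f g H n x,
  `|diffusion_op (cut_grad f g n) (cut_hess f g H n) x| <=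
  `|diffusion_op g H x| + C * (`|f x| + \sum_i `|g i x|).
Proof.
have bA0 : 0 <= bound_A by apply: sumr_ge0 => i _; apply: sumr_ge0.
have B0 : 0 <= 30 + S * (6 + k%:R * 6) by rewrite !(addr_ge0, mulr_ge0).
exists (bound_A * (30 + S * (6 + k%:R * 6)) + bound_A * 12).
  by rewrite addr_ge0// mulr_ge0.
move=> f g H n x; rewrite diffusion_op_prod.
have c1 : `|f x * diffusion_op (cutoff_grad n) (cutoff_hess n) x| <=
    bound_A * (30 + S * (6 + k%:R * 6)) * `|f x|.
  by rewrite normrM mulrC ler_wpM2r// diffusion_op_cutoff_bound.
have c2 : `|cutoff n x * diffusion_op g H x| <= `|diffusion_op g H x|.
  have /andP[h0 h1] := cutoff_bound n x.
  by rewrite normrM ger0_norm// ler_piMl.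
have c3 : `|\sum_i \sum_j A i j * (g i x * cutoff_grad n j x + cutoff_grad n i x * g j x)|
    <= bound_A * (12 * \sum_i `|g i x|).
  apply: ler_sumA => i j; apply: (le_trans (ler_normD _ _)).
  rewrite [`|_ * cutoff_grad _ _ _|]normrM [`|cutoff_grad _ _ _ * _|]normrM.
  have le_sum l : `|g l x| <= \sum_i `|g i x|.
    by rewrite (bigD1 l)//= lerDl; apply: sumr_ge0.
  have gb l := cutoff_grad_bound n l x.
  have := ler_pM (normr_ge0 _) (normr_ge0 _) (le_sum i) (gb j).
  have := ler_pM (normr_ge0 _) (normr_ge0 _) (gb i) (le_sum j).
  lra.
have sum0 : 0 <= \sum_i `|g i x| by apply: sumr_ge0.
set u := _ * diffusion_op _ _ x in c1 *; set v := _ * diffusion_op _ _ x in c2 *;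
  set w := \sum_i _ in c3 *.
have -> : (bound_A * (30 + S * (6 + k%:R * 6)) + bound_A * 12) *
    (`|f x| + \sum_i `|g i x|) =
  bound_A * (30 + S * (6 + k%:R * 6)) * `|f x| + bound_A * (12 * \sum_i `|g i x|) +
  (bound_A * (30 + S * (6 + k%:R * 6)) * (\sum_i `|g i x|) + bound_A * 12 * `|f x|) by ring.
have r0 : 0 <= bound_A * (30 + S * (6 + k%:R * 6)) * (\sum_i `|g i x|) + bound_A * 12 * `|f
  x|.
  by rewrite addr_ge0// !mulr_ge0.
by move: c1 c2 c3; rewrite !ler_norml; lra.
Qed.

Lemma cvg_diffusion_op_cut f g H x :
  diffusion_op (cut_grad f g n) (cut_hess f g H n) x @[n --> \oo] --> diffusion_op g H x.
Proof.
have -> : diffusion_op g H x = \sum_i \sum_j A i j *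
    ((f x * 0 + 1 * H i j x + (g i x * 0 + 0 * g j x)) + s i x * (f x * 0 + 1 * g j x)).
  by apply: eq_bigr => i _; apply: eq_bigr => j _; ring.
apply: cvg_big => [|i _]; first exact: add_continuous.
apply: cvg_big => [|j _]; first exact: add_continuous.
apply: cvgM; first exact: cvg_cst.
apply: cvgD.
  apply: cvgD.
    apply: cvgD; apply: cvgM; [exact: cvg_cst|exact: cvg_cutoff_hess|
      exact: cvg_cutoff|exact: cvg_cst].
  apply: cvgD; apply: cvgM; [exact: cvg_cst|exact: cvg_cutoff_grad|
    exact: cvg_cutoff_grad|exact: cvg_cst].
apply: cvgM; first exact: cvg_cst.
by apply: cvgD; apply: cvgM; [exact: cvg_cst|exact: cvg_cutoff_grad|
  exact: cvg_cutoff|exact: cvg_cst].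
Qed.

End second_order_operator.

(** * Linear observables *)

Section linear_observables.
Context {R : realType} {k : nat} {d : measure_display} {Om : measurableType d}.
Notation V := 'rV[R]_k.
Variables (P : probability Om R) (Pi : probability V R).
Variables (X : R -> Om -> V) (Q : R -> R.-pker V ~> V).
Variable G : (V -> R) -> V -> R.
Hypothesis mX : forall t, 0 <= t -> measurable_fun setT (X t).
Hypothesis lawX : forall t, 0 <= t -> forall A, measurable A ->
  P (X t @^-1` A) = Pi A.
Hypothesis markov : forall s t, 0 <= s -> 0 <= t ->
  forall E B, natural_filtration X s E -> measurable B ->
    P (E `&` X (s + t) @^-1` B) = (\int[P]_(w in E) Q t (X s w) B)%E.
Hypothesis gen : has_L2_generator Pi Q G.
Variables (A : 'M[R]_k) (s : 'I_k -> V -> R) (S : R).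
Hypothesis S0 : 0 <= S.
Hypothesis s_growth : forall i x, `|s i x| <= S * (1 + \sum_l `|x 0 l|).
Hypothesis cs : forall i, continuous (s i).
Hypothesis ms : forall i, measurable_fun setT (s i).
Hypothesis moments : forall l, square_integrable Pi (fun x : V => x 0 l).
Hypothesis GE : forall f g H, jet f g H -> G f = diffusion_op A s g H.

Lemma square_integrable_growth i : square_integrable Pi (s i).
Proof.
apply: square_integrable_dominated (ms i) (s_growth i) _; apply: square_integrableZ.
apply: (square_integrableD (f := fun=> 1));
  first by apply: (@square_integrable_bounded _ _ _ _ _ 1) => // x; rewrite normr1.
by apply: square_integrable_sum => l; exact: square_integrable_norm.
Qed.

Lemma core_vanishing f g H (M : R) : jet f g H -> measurable_fun setT f ->
  (forall i, measurable_fun setT (g i)) -> (forall i j, measurable_fun setT (H i j)) ->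
  (forall x, M <= normsq x ->
    [/\ f x = 0, forall i, g i x = 0 & forall i j, H i j x = 0]) ->
  core Pi G f.
Proof.
move=> J mf mg mH v; have [cf Df cg Dg cH] := J; split.
- split; first exact: jet_C2 J.
  by apply: (@compact_support_normsq _ _ _ M) => x /v[].
- split => //; apply: (@bounded_vanishing _ _ _ M) => // x /v[] //.
- rewrite (GE J); have [B HB] : exists B, forall x, `|diffusion_op A s g H x| <= B.
    apply: (@bounded_vanishing _ _ _ M) => [|x /v[_ g0 H0]]; last exact: diffusion_op_eq0.
    exact: continuous_diffusion_op.
  by apply: square_integrable_bounded HB; exact: measurable_diffusion_op.
Qed.

(** * Removal of the cutoff *)

Section truncation.
Variables (f : V -> R) (g : 'I_k -> V -> R) (H : 'I_k -> 'I_k -> V -> R).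
Hypothesis J : jet f g H.
Hypothesis mf : measurable_fun setT f.
Hypothesis mg : forall i, measurable_fun setT (g i).
Hypothesis mH : forall i j, measurable_fun setT (H i j).

Let fcut n x := f x * cutoff n x.

Let jet_fcut n : jet (fcut n) (cut_grad f g n) (cut_hess f g H n).
Proof. exact: jetM J (jet_cutoff n). Qed.

Let G_fcut n : G (fcut n) = diffusion_op A s (cut_grad f g n) (cut_hess f g H n).
Proof. exact: GE (jet_fcut n). Qed.

Let vanish n x : n.+1%:R <= normsq x -> [/\ fcut n x = 0,
  forall i, cut_grad f g n i x = 0 & forall i j, cut_hess f g H n i j x = 0].
Proof.
move=> /cutoff_support[c0 g0 H0]; split=> [|i|i j].
- by rewrite /fcut c0 mulr0.
- by rewrite /cut_grad c0 g0 mulr0 mul0r addr0.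
- by rewrite /cut_hess c0 !g0 H0 !mulr0 !mul0r !addr0.
Qed.

Let m_fcut n : measurable_fun setT (fcut n).
Proof. by apply: measurable_funM => //; exact: measurable_cutoff. Qed.

Let m_grad n i : measurable_fun setT (cut_grad f g n i).
Proof.
apply: measurable_funD; apply: measurable_funM => //;
  by [exact: measurable_cutoff|exact: measurable_cutoff_grad].
Qed.

Let m_hess n i j : measurable_fun setT (cut_hess f g H n i j).
Proof.
apply: measurable_funD; apply: measurable_funD; apply: measurable_funM => //;
  by [exact: measurable_cutoff|exact: measurable_cutoff_grad|exact: measurable_cutoff_hess].
Qed.

Let core_fcut n : core Pi G (fcut n).
Proof. exact: core_vanishing (jet_fcut n) _ _ _ (@vanish n). Qed.

Let core_sub m n : core Pi G (fun x => fcut m x - fcut n x).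
Proof.
apply: (core_vanishing (M := m.+1%:R + n.+1%:R) (jetB (jet_fcut m) (jet_fcut n))).
- exact: measurable_funB.
- by move=> i; exact: measurable_funB.
- by move=> i j; exact: measurable_funB.
move=> x Mx.
have [|f1 g1 H1] := @vanish m x; first by rewrite (le_trans _ Mx)// lerDl.
have [|f2 g2 H2] := @vanish n x; first by rewrite (le_trans _ Mx)// lerDr.
by split=> [|i|i j]; rewrite ?f1 ?f2 ?g1 ?g2 ?H1 ?H2 subrr.
Qed.

Let G_sub m n x : G (fun y => fcut m y - fcut n y) x = G (fcut m) x - G (fcut n) x.
Proof. by rewrite (GE (jetB (jet_fcut m) (jet_fcut n))) diffusion_opB !G_fcut. Qed.

Let cvg_fcut x : fcut n x @[n --> \oo] --> f x.
Proof.
rewrite -[X in _ --> X]mulr1; apply: cvgM; first exact: cvg_cst.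
exact: cvg_cutoff.
Qed.

Let cvg_Gfcut x : G (fcut n) x @[n --> \oo] --> diffusion_op A s g H x.
Proof.
have := @cvg_diffusion_op_cut _ _ A s f g H x.
by apply: cvg_near_eq; apply: nearW => n; rewrite G_fcut.
Qed.

Let fcut_bound n x : `|fcut n x| <= `|f x|.
Proof.
have /andP[c0 c1] := cutoff_bound n x.
by rewrite normrM (ger0_norm c0) ler_piMr.
Qed.

(** The hypotheses are of L^1 type because the lemma is meant for the square of a linear form, which
    under finite second moments need not be square integrable. Dominated convergence of the means
    suffices here. *)
Lemma diffusion_op_mean0 : Pi.-integrable setT (EFin \o diffusion_op A s g H) ->
  Pi.-integrable setT (EFin \o (fun x => `|f x| + \sum_i `|g i x|)) ->
  \int[Pi]_x diffusion_op A s g H x = 0.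
Proof.
move=> I1 I2; have [C C0 HC] := diffusion_op_cut_bound A S0 s_growth.
have [||||_ c] := @dominated_cvg_Rintegral _ _ _ Pi (fun n => G (fcut n))
  (diffusion_op A s g H) (fun x => `|diffusion_op A s g H x| + C * (`|f x| + \sum_i `|g i
    x|)).
- by move=> n; have [_ _ []] := core_fcut n.
- exact: cvg_Gfcut.
- by apply: integrableRD; [exact: (integrable_norm I1)|exact: integrableRZ].
- by move=> n x; rewrite G_fcut.
apply/esym; apply: (cvg_unique _ _ c) => //.
apply: cvg_near_eq (cvg_cst 0); near=> n.
by rewrite /= (generator_mean0 mX lawX markov gen).
Unshelve. all: by end_near. Qed.

Lemma diffusion_op_lag_derivative : square_integrable Pi (diffusion_op A s g H) ->
  square_integrable Pi f ->
  (forall i, square_integrable Pi (g i)) ->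
  t^-1 * (lag_moment P X f f t - lag_moment P X f f 0) @[t --> 0^'+] -->
  \int[Pi]_x (f x * diffusion_op A s g H x).
Proof.
move=> sG sf sg; have [C C0 HC] := diffusion_op_cut_bound A S0 s_growth.
apply: (limit_lag_moment_derivative (f_ := fcut) (F := fun x => `|f x|)
  (H := fun x => `|diffusion_op A s g H x| + C * (`|f x| + \sum_i `|g i x|)) mX lawX markov
    gen) => //.
- exact: square_integrable_norm.
- apply: square_integrableD; first exact: square_integrable_norm.
  apply: square_integrableZ; apply: square_integrableD; first exact: square_integrable_norm.
  by apply: square_integrable_sum => i; exact: square_integrable_norm.
- by move=> n x; rewrite G_fcut.
Qed.

End truncation.

Variable v : V.
Let f (x : V) : R := (v *m x^T) 0 0.
Let Gf x := \sum_i \sum_j A i j * (s i x * v 0 j).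

Let gopf : diffusion_op A s (fun i => cst (v 0 i)) (fun _ _ => cst 0) = Gf.
Proof.
by apply/funext => x; apply: eq_bigr => i _; apply: eq_bigr => j _; rewrite add0r.
Qed.

Lemma square_integrable_linear_form : square_integrable Pi f.
Proof.
rewrite /f; under eq_fun do rewrite dotE.
by apply: square_integrable_sum => l; exact: square_integrableZ.
Qed.

Lemma square_integrable_generator_linear : square_integrable Pi Gf.
Proof.
apply: square_integrable_sum => i; apply: square_integrable_sum => j;
  apply: square_integrableZ.
under eq_fun do rewrite mulrC; apply: square_integrableZ; exact: square_integrable_growth.
Qed.

Let mf : measurable_fun setT f. Proof. by case: square_integrable_linear_form. Qed.

Let square_integrable_cst (c : R) : square_integrable Pi (cst c).
Proof. by apply: (@square_integrable_bounded _ _ _ _ _ `|c|). Qed.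

(* Stationarity applied to f^2, whose generator is 2 f Gf + 2 v A v'. *)
Lemma linear_dirichlet_form :
  \int[Pi]_x (f x * Gf x) = - \sum_i \sum_j A i j * (v 0 i * v 0 j).
Proof.
have J2 := jetM (jet_linear_form v) (jet_linear_form v).
set c := \sum_i _.
have E : diffusion_op A s (fun i x => f x * v 0 i + f x * v 0 i)
    (fun i j x => f x * 0 + f x * 0 + (v 0 i * v 0 j + v 0 i * v 0 j)) =
    (fun x => 2 * (f x * Gf x) + 2 * c).
  apply/funext => x; rewrite (diffusion_op_prod A s f (fun i => cst (v 0 i)) (fun _ _ =>
    cst 0)
     f (fun i => cst (v 0 i)) (fun _ _ => cst 0)) gopf.
  have -> : \sum_i \sum_j A i j * (cst (v 0 i) x * cst (v 0 j) x + cst (v 0 i) x * cst (v 0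
    j) x)
      = 2 * c.
    rewrite /c big_distrr/=; apply: eq_bigr => i _; rewrite big_distrr/=.
    by apply: eq_bigr => j _; ring.
  by ring.
have I1 := square_integrable_mul square_integrable_linear_form
  square_integrable_generator_linear.
have := diffusion_op_mean0 J2; rewrite /cst E.
have If := square_integrable_integrable (square_integrable_norm
  square_integrable_linear_form).
have H1 : \int[Pi]_x (2 * (f x * Gf x) + 2 * c) = 2 * (\int[Pi]_x (f x * Gf x)) + 2 * c.
  rewrite RintegralD//.
  - by rewrite RintegralZl// Rintegral_prob_cst.
  - exact: integrableRZ.
  - exact: square_integrable_integrable (square_integrable_cst _).
rewrite H1 => K; suff : 2 * (\int[Pi]_x (f x * Gf x)) + 2 * c = 0 by lra.
apply: K.
- exact: measurable_funM.
- by move=> i; apply: measurable_funD; exact: measurable_funM.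
- move=> i j; apply: measurable_funD => //.
  by apply: measurable_funD; exact: measurable_funM.
- by apply: integrableRD;
  [exact: integrableRZ|exact: square_integrable_integrable (square_integrable_cst _)].
- apply: integrableRD.
    have := integrable_norm (square_integrable_mul square_integrable_linear_form
      square_integrable_linear_form).
    by [].
  apply: integrableR_sum => i.
  have -> : (fun x => `|f x * v 0 i + f x * v 0 i|) = (fun x => (2 * `|v 0 i|) * `|f x|).
    apply/funext => x; rewrite (_ : f x * v 0 i + f x * v 0 i = 2 * v 0 i * f x);
      last by ring.
    by rewrite !normrM (ger0_norm (ler0n _ 2)).
  exact: integrableRZ.
Qed.

Lemma linear_lag_derivative :
  t^-1 * (lag_moment P X f f t - lag_moment P X f f 0) @[t --> 0^'+] -->
  - \sum_i \sum_j A i j * (v 0 i * v 0 j).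
Proof.
rewrite -linear_dirichlet_form -gopf.
apply: (diffusion_op_lag_derivative (jet_linear_form v)) => //.
- by rewrite gopf; exact: square_integrable_generator_linear.
- exact: square_integrable_linear_form.
Qed.

End linear_observables.

(** * Boxes and positive densities *)

Section boxes.
Context {R : realType}.

Definition box n (a b : 'I_n -> R) : set 'rV[R]_n :=
  [set x | forall i, a i <= x 0 i <= b i].

Lemma measurable_box n (a b : 'I_n -> R) : measurable (box a b).
Proof.
rewrite (_ : box a b = \bigcap_(i in [set: 'I_n])
    ((fun x : 'rV[R]_n => x 0 i) @^-1` `[a i, b i]%classic)).
  apply: fin_bigcap_measurable => // i _.
  rewrite -[X in measurable X]setTI; exact: measurable_coord.
apply/seteqP; split => x /= H i; first by move=> _; rewrite /= in_itv/=; exact: H.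
by have := H i Logic.I; rewrite /= in_itv.
Qed.

Lemma lebesgue_box n (a b : 'I_n -> R) : (forall i, a i <= b i) ->
  lebesgue_rV n (box a b) = (\prod_i (b i - a i))%:E.
Proof.
elim: n a b => [|n IH] a b ab.
  rewrite big_ord0 /= diracE (_ : _ \in _ = true)//.
  by apply/mem_set => -[].
rewrite /= /lebesgue_step /pushforward.
have -> : @row_cons R n @^-1` box a b = `[a ord0, b ord0]%classic `*`
    box (fun i => a (lift ord0 i)) (fun i => b (lift ord0 i)).
  have E0 (x : R * 'rV[R]_n) : row_cons x 0 ord0 = x.1.
    by have := row_consK x; case: x => y z [].
  have E1 (x : R * 'rV[R]_n) i : row_cons x 0 (lift ord0 i) = x.2 0 i.
    rewrite /row_cons (_ : lift ord0 i = rshift 1 i); last exact/val_inj.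
    by rewrite (@row_mxEr _ 1 1 n).
  apply/seteqP; split => x /=.
    move=> H; split; first by rewrite /= in_itv/= -E0; exact: H.
    by move=> i; rewrite -E1; exact: H.
  rewrite in_itv/= => -[H0 H1] i; have [j ->|->] := unliftP ord0 i.
    by rewrite E1; exact: H1.
  by rewrite E0.
rewrite product_measure1E; [|exact: measurable_itv|exact: measurable_box].
rewrite IH// big_ord_recl EFinM; congr (_ * _)%E.
transitivity (lebesgue_measure (`[a ord0, b ord0]%classic : set R)) => //.
rewrite lebesgue_measure_itv/= lte_fin.
have [//|h] := ltP (a ord0) (b ord0).
by have -> : a ord0 = b ord0; [apply/le_anti; rewrite ab h|rewrite subrr].
Qed.

Lemma ball_box n (x : 'rV[R]_n) (e : R) : 0 < e ->
  box (fun i => x 0 i - e / 2) (fun i => x 0 i + e / 2) `<=` ball x e.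
Proof.
move=> e0 y /= H; split => // i j; rewrite (ord1 i) /ball/= ltr_distlC.
by have := H j; lra.
Qed.

End boxes.

Section positive_density.
Context {R : realType} {k : nat}.
Variables (Pi : probability 'rV[R]_k R) (p : 'rV[R]_k -> R).
Hypothesis dens : has_lebesgue_density Pi p.

Lemma density_box_lower (a b : 'I_k -> R) (c : R) : (forall i, a i <= b i) ->
  0 <= c -> (forall x, box a b x -> c <= p x) ->
  ((c * \prod_i (b i - a i))%:E <= Pi (box a b))%E.
Proof.
move=> ab c0 cp; have [mp p0 ->] := dens; last exact: measurable_box.
rewrite EFinM -(lebesgue_box ab) -integral_cst; last exact: measurable_box.
apply: ge0_le_integral => //; first [exact: measurable_box
  | by apply/measurable_EFinP; exact: measurable_funTS
  | by move=> x Bx; rewrite lee_fin ?cp].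
Qed.

Hypothesis ppos : forall x, 0 < p x.

(** A null box would force p to vanish almost everywhere on it; as p is positive, the box would have
    Lebesgue measure 0, against its positive volume. *)
Lemma density_box_gt0 (a b : 'I_k -> R) : (forall i, a i < b i) ->
  (0 < Pi (box a b))%E.
Proof.
move=> ab; have [mp p0 pE] := dens; have mB := measurable_box a b.
rewrite lt0e measure_ge0 andbT; apply/eqP; rewrite pE// => I0.
have : (\int[lebesgue_rV k]_(x in box a b) `|(p x)%:E| = 0)%E.
  by rewrite -[RHS]I0; apply: eq_integral => x _; rewrite gee0_abs// lee_fin.
move/ae_eq_integral_abs => /(_ mB) H.
have {}H : ae_eq (lebesgue_rV k) (box a b) (EFin \o p) (cst 0%E).
  by apply: H; apply/measurable_EFinP; exact: measurable_funTS.
have : lebesgue_rV k (box a b) = 0%E.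
  have [N [mN N0 sub]] := H.
  apply/eqP; rewrite eq_le measure_ge0 andbT -N0 le_measure// ?inE// => x Bx.
  by apply: sub => /= /(_ Bx) [] /eqP; rewrite gt_eqF.
rewrite lebesgue_box => [|i]; last exact: ltW.
move=> /(congr1 fine)/= /eqP; by rewrite gt_eqF// prodr_gt0// => i _; rewrite subr_gt0.
Qed.

(** Pi has full support: where q is positive it exceeds half its value on a whole box, which has
    positive mass. Both nondegeneracy statements, for the covariance and for the score, rest on
    this. *)
Lemma continuous_mean0 (q : 'rV[R]_k -> R) : continuous q ->
  (forall x, 0 <= q x) -> Pi.-integrable setT (EFin \o q) ->
  \int[Pi]_x q x = 0 -> forall x, q x = 0.
Proof.
move=> cq q0 Iq I0 x; apply/eqP; rewrite eq_le q0 andbT leNgt; apply/negP => qx.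
have q2 : 0 < q x / 2 by rewrite divr_gt0.
have /nbhs_ballP[e /= e0 He] : \forall y \near x, q x / 2 < q y.
  have /cvgrPdist_lt/(_ _ q2) := cq x; apply: filterS => y.
  by rewrite ltr_distlC; lra.
have ep : 0 < e by exact: e0.
have ab i : x 0 i - e / 2 < x 0 i + e / 2 by lra.
have Bpos := density_box_gt0 ab.
set B := box _ _ in Bpos; have mB : measurable B := measurable_box _ _.
have : q x / 2 * fine (Pi B) <= 0.
  rewrite -I0; have -> : q x / 2 * fine (Pi B) = \int[Pi]_y (q x / 2 * \1_B y).
    rewrite RintegralZl//; last exact: integrable_indic.
    by rewrite /Rintegral integral_indic// setIT.
  apply: le_Rintegral => //.
    by apply: integrableRZ; exact: integrable_indic.
  move=> y _; rewrite indicE; case: (boolP (y \in B)) => /=.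
    rewrite inE => yB; rewrite mulr1; apply: ltW; apply: He; exact: ball_box.
  by rewrite mulr0.
apply/negP; rewrite -ltNge mulr_gt0// fine_gt0// Bpos/=.
by rewrite (le_lt_trans (probability_le1 _ mB))// ltry.
Qed.

End positive_density.

(** * Variance matrices and the score *)

Section covariance_matrices.
Context {d} {T : measurableType d} {R : realType} (P : probability T R).

Lemma fine_covarianceE (U V : T -> R) : fine (covariance P U V) =
  \int[P]_w ((U w - \int[P]_w U w) * (V w - \int[P]_w V w)).
Proof. by rewrite !unlock. Qed.

End covariance_matrices.

Section variance_matrices.
Context {R : realType} {k : nat} (Pi : probability 'rV[R]_k R).
Implicit Types (h : 'rV[R]_k -> 'rV[R]_k) (L : 'M[R]_k).

(** The transposed entry [L j i] matches the index order of [frobenius]. *)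
Lemma quadE L (c : 'rV[R]_k) : (c *m L *m c^T) 0 0 = \sum_i \sum_j L j i * (c 0 i * c 0 j).
Proof.
rewrite mxE; apply: eq_bigr => i _; rewrite !mxE big_distrl/=.
by apply: eq_bigr => j _; ring.
Qed.

Definition mean_vec h : 'rV[R]_k := \row_i \int[Pi]_x h x 0 i.

Section moments.
Variable h : 'rV[R]_k -> 'rV[R]_k.
Hypothesis sh : forall i, square_integrable Pi (fun x => h x 0 i).
Let m := mean_vec h.

Let sc i : square_integrable Pi (fun x => (h x - m) 0 i).
Proof.
have -> : (fun x => (h x - m) 0 i) = (fun x => h x 0 i - m 0 i).
  by apply/funext => x; rewrite !mxE.
by apply: square_integrableB => //; apply: (@square_integrable_bounded _ _ _ _ _ `|m 0 i|).
Qed.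

Let varE i j : variance_mx Pi h i j = \int[Pi]_x ((h x - m) 0 i * (h x - m) 0 j).
Proof.
by rewrite mxE fine_covarianceE; apply: eq_Rintegral => x _; rewrite !mxE.
Qed.

Let integrable_term L i j :
  Pi.-integrable setT (EFin \o (fun x => L j i * ((h x - m) 0 i * (h x - m) 0 j))).
Proof. by apply: integrableRZ; exact: square_integrable_mul. Qed.

Lemma integrable_quad L :
  Pi.-integrable setT (EFin \o (fun x => ((h x - m) *m L *m (h x - m)^T) 0 0)).
Proof.
under eq_fun do rewrite quadE.
by apply: integrableR_sum => i; apply: integrableR_sum => j; exact: integrable_term.
Qed.

(** The trace identity tr(L E[c' c]) = E[c L c'] for rows c. It makes the pairing with a variance
    nonnegative without diagonalisation or matrix square roots. *)
Lemma frobenius_variance L : frobenius L (variance_mx Pi h) =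
  \int[Pi]_x ((h x - m) *m L *m (h x - m)^T) 0 0.
Proof.
under eq_Rintegral do rewrite quadE.
rewrite Rintegral_sum => [|i]; last by apply: integrableR_sum => j; exact: integrable_term.
apply: eq_bigr => i _; rewrite Rintegral_sum => [|j]; last exact: integrable_term.
by apply: eq_bigr => j _; rewrite RintegralZl ?varE//; exact: square_integrable_mul.
Qed.

Let integrable_dot (v : 'rV[R]_k) :
  Pi.-integrable setT (EFin \o (fun x => (v *m (h x - m)^T) 0 0 ^+ 2)).
Proof.
suff [] : square_integrable Pi (fun x => (v *m (h x - m)^T) 0 0) by [].
by under eq_fun do rewrite dotE; apply: square_integrable_sum => i;
  exact: square_integrableZ.
Qed.

Lemma variance_quad (v : 'rV[R]_k) : (v *m variance_mx Pi h *m v^T) 0 0 =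
  \int[Pi]_x (v *m (h x - m)^T) 0 0 ^+ 2.
Proof.
have E x : (v *m (h x - m)^T) 0 0 ^+ 2 =
    \sum_i \sum_j (v 0 i * v 0 j) * ((h x - m) 0 i * (h x - m) 0 j).
  rewrite dotE expr2 big_distrl/=; apply: eq_bigr => i _.
  by rewrite big_distrr/=; apply: eq_bigr => j _; ring.
have It i j : Pi.-integrable setT
    (EFin \o (fun x => (v 0 i * v 0 j) * ((h x - m) 0 i * (h x - m) 0 j))).
  by apply: integrableRZ; exact: square_integrable_mul.
under eq_Rintegral do rewrite E.
rewrite quadE Rintegral_sum => [|i]; last exact: integrableR_sum.
apply: eq_bigr => i _; rewrite Rintegral_sum//.
apply: eq_bigr => j _; rewrite RintegralZl//; last exact: square_integrable_mul.
rewrite varE mulrC; congr (_ * _).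
by apply: eq_Rintegral => x _; rewrite mulrC.
Qed.

Lemma variance_mx_sym : (variance_mx Pi h)^T = variance_mx Pi h.
Proof. by apply/matrixP => i j; rewrite mxE !varE; apply: eq_Rintegral => x _;
  rewrite mulrC. Qed.

Lemma frobenius_variance_ge0 L :
  (forall v : 'rV[R]_k, 0 <= (v *m L *m v^T) 0 0) -> 0 <= frobenius L (variance_mx Pi h).
Proof. by move=> L0; rewrite frobenius_variance; apply: Rintegral_ge0. Qed.

End moments.

(** * Nondegeneracy under a positive density *)

Section nondegeneracy.
Variable p : 'rV[R]_k -> R.
Hypothesis dens : has_lebesgue_density Pi p.
Hypothesis ppos : forall x, 0 < p x.

Lemma spd_variance_id : (forall i, square_integrable Pi (fun x : 'rV[R]_k => x 0 i)) ->
  spd (variance_mx Pi id).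
Proof.
move=> sx; split; first exact: variance_mx_sym.
move=> v v0; rewrite lt0r; set V := _ 0 0; have VE := variance_quad sx v.
rewrite -/V in VE; rewrite {2}VE Rintegral_ge0 ?andbT; last first.
  by move=> x _; exact: sqr_ge0.
apply: contra_neq v0 => V0.
have cq : continuous (fun x : 'rV[R]_k => (v *m (x - mean_vec id)^T) 0 0 ^+ 2).
  have J := jetB (jet_linear_form v) (jet_cst ((v *m (mean_vec id)^T) 0 0)).
  have [cl _ _ _ _] := jetM J J.
  have -> : (fun x : 'rV[R]_k => (v *m (x - mean_vec id)^T) 0 0 ^+ 2) =
      (fun x => ((v *m x^T) 0 0 - (v *m (mean_vec id)^T) 0 0) *
                ((v *m x^T) 0 0 - (v *m (mean_vec id)^T) 0 0)).
    apply/funext => x; rewrite !dotE -sumrB -expr2; congr (_ ^+ 2).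
    by apply: eq_bigr => i _; rewrite !mxE mulrBr.
  exact: cl.
have sv : square_integrable Pi (fun x : 'rV[R]_k => (v *m (x - mean_vec id)^T) 0 0).
  under eq_fun do rewrite dotE; apply: square_integrable_sum => i;
    apply: square_integrableZ.
  have -> : (fun x : 'rV[R]_k => (x - mean_vec id) 0 i) = (fun x => x 0 i - mean_vec id 0
    i).
    by apply/funext => x; rewrite !mxE.
  by apply: square_integrableB => //;
    apply: (@square_integrable_bounded _ _ _ _ _ `|mean_vec id 0 i|).
have q0 := continuous_mean0 dens ppos cq (fun x => sqr_ge0 _) sv.2 (etrans (esym VE) V0).
have z (x : 'rV[R]_k) : (v *m (x - mean_vec id)^T) 0 0 = 0.
  by apply/eqP; have /eqP := q0 x; rewrite expf_eq0.
(* The form v (x - m)' vanishes for every x; at x = m + v it is the sum of the squares of the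
   entries of v. *)
have := z (mean_vec id + v); rewrite addrAC subrr add0r dotE => /eqP.
rewrite psumr_eq0 => [/allP v2|i _]; last by rewrite -expr2 sqr_ge0.
apply/rowP => i; rewrite mxE; have := v2 i (mem_index_enum _).
by rewrite mulf_eq0 orbb => /eqP.
Qed.

Lemma frobenius_variance_gt0 h L : (forall i, square_integrable Pi (fun x => h x 0 i)) ->
  (forall i, continuous (fun x => h x 0 i)) -> spd L ->
  (forall c, ~ forall x, h x = c) -> 0 < frobenius L (variance_mx Pi h).
Proof.
move=> sh ch [Lsym Lpos] hn.
have L0 (v : 'rV[R]_k) : 0 <= (v *m L *m v^T) 0 0.
  by have [->|/Lpos/ltW//] := eqVneq v 0; rewrite !mul0mx mxE.
rewrite lt0r frobenius_variance_ge0// andbT; apply/eqP; rewrite frobenius_variance// => I0.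
apply: (hn (mean_vec h)) => x.
have cq : continuous (fun x => ((h x - mean_vec h) *m L *m (h x - mean_vec h)^T) 0 0).
  under eq_fun do rewrite quadE.
  apply: continuous_sum => i; apply: continuous_sum => j y.
  have c l : (h z - mean_vec h) 0 l @[z --> y] --> (h y - mean_vec h) 0 l.
    have -> : (fun z => (h z - mean_vec h) 0 l) = (fun z => h z 0 l - mean_vec h 0 l).
      by apply/funext => z; rewrite !mxE.
    rewrite [X in _ --> X](_ : _ = h y 0 l - mean_vec h 0 l); last by rewrite !mxE.
    exact: (cvgB (ch l y) (cvg_cst (mean_vec h 0 l))).
  exact: (cvgM (cvg_cst (L j i)) (cvgM (c i) (c j))).
have q0 := continuous_mean0 dens ppos cq (fun x => L0 _) (integrable_quad sh L) I0 x.
apply/eqP; rewrite -subr_eq0; apply/negP => /negP /Lpos.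
by rewrite q0 ltxx.
Qed.

End nondegeneracy.
End variance_matrices.

(** * Growth, measurability and non-constancy of the score *)

Section score.
Context {R : realType} {k : nat} (Pi : probability 'rV[R]_k R).
Variable p : 'rV[R]_k -> R.
Hypothesis dens : has_lebesgue_density Pi p.
Hypothesis lip : lipschitz_score p.

Let lnp x := ln (p x).
Let s i := partial i lnp.
Let ppos x : 0 < p x. Proof. by case: lip. Qed.
Let dp x : differentiable lnp x. Proof. by case: lip. Qed.

Lemma normr_coord_le (x : 'rV[R]_k) i : `|x 0 i| <= `|x|.
Proof.
rewrite [leRHS]/Num.norm/= mx_normrE.
by apply/bigmax_geP; right; exists (0, i).
Qed.

Lemma norm_le_sum (x : 'rV[R]_k) : `|x| <= \sum_l `|x 0 l|.
Proof.
rewrite [leLHS]/Num.norm/= mx_normrE; apply/bigmax_leP; split.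
  by apply: sumr_ge0.
move=> [i j] _ /=; rewrite (ord1 i) (bigD1 j)//= lerDl.
by apply: sumr_ge0.
Qed.

Lemma score_lipschitz : exists2 M, 0 <= M &
  forall i x y, `|s i x - s i y| <= M * `|x - y|.
Proof.
have [_ _ [M0 [_ HM]]] := lip.
exists (`|M0| + 1) => [|i x y]; first by rewrite addr_ge0.
have := HM (`|M0| + 1) _ (x, y); rewrite /= => /(_ _ (conj I I)) H.
have {H} : `|gradient lnp x - gradient lnp y| <= (`|M0| + 1) * `|x - y|.
  by apply: H; rewrite (le_lt_trans (ler_norm M0))// ltrDl.
apply: le_trans; have := normr_coord_le (gradient lnp x - gradient lnp y) i.
by rewrite !mxE.
Qed.

Lemma score_growth : exists2 S, 0 <= S &
  forall i x, `|s i x| <= S * (1 + \sum_l `|x 0 l|).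
Proof.
have [M M0 HM] := score_lipschitz.
have s0 : 0 <= \sum_j `|s j 0| by apply: sumr_ge0.
exists (\sum_j `|s j 0| + M); first exact: addr_ge0.
move=> i x; have sx : 0 <= \sum_l `|x 0 l| by apply: sumr_ge0.
have h1 : `|s i x - s i 0| <= M * \sum_l `|x 0 l|.
  by rewrite (le_trans (HM i x 0))// subr0 ler_wpM2l// norm_le_sum.
have h2 : `|s i 0| <= \sum_j `|s j 0|.
  by rewrite (bigD1 i)//= lerDl; apply: sumr_ge0.
have := ler_normD (s i x - s i 0) (s i 0); rewrite subrK.
have := mulr_ge0 s0 sx; have := mulr_ge0 M0 sx; lra.
Qed.

Lemma continuous_score i : continuous (s i).
Proof.
have [M M0 HM] := score_lipschitz.
suff H (x : 'rV[R]_k) : s i y @[y --> x] --> s i x by move=> x; exact: H.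
apply/(@cvgrPdist_le _ _ _ _ (nbhs_filter x)) => e e0.
have M1 : 0 < M + 1 by rewrite ltr_wpDl.
have eM : 0 < e / (M + 1) by rewrite divr_gt0.
have : \forall y \near x, `|x - y| <= e / (M + 1).
  by have /cvgrPdist_le/(_ _ eM) := @cvg_id _ (nbhs x).
apply: filterS => y xy; apply: (le_trans (HM i x y)).
apply: (@le_trans _ _ ((M + 1) * `|x - y|)); first by rewrite ler_wpM2r// lerDl.
by rewrite mulrC -ler_pdivlMr.
Qed.

(** The sigma-algebra is generated by the coordinates rather than by open sets, so continuity is not
    the route taken: a partial derivative is a sequential limit of difference quotients of ln p,
    measurable because p is. *)
Lemma measurable_score i : measurable_fun setT (s i).
Proof.
have [mp _ _] := dens.
pose u n x := n.+1%:R * (lnp (n.+1%:R^-1 *: delta_mx 0 i + x) - lnp x).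
have mu n : measurable_fun setT (u n).
  apply: measurable_funM => //; apply: measurable_funB.
    apply: (measurableT_comp (@measurable_ln R)); apply: (measurableT_comp mp).
    apply/measurable_fun_mxP => a b.
    under eq_fun do rewrite mxE; apply: measurable_funD => //; exact: measurable_coord.
  by apply: (measurableT_comp (@measurable_ln R)).
apply: (measurable_fun_cvg mu) => x _; have := diff_derivable (v := delta_mx 0 i) (dp x).
rewrite /derivable => D.
have seq0 : n.+1%:R^-1 @[n --> \oo] --> (0 : R)^'.
  move=> B B0; have B0' : nbhs (0 : R) (fun y : R => y != 0 -> B y) by exact: B0.
  have [N _ HN] := @cvg_harmonic R _ B0'; exists N => // n /= Nn.
  by apply: HN => //=; rewrite invr_eq0 pnatr_eq0.
have := cvg_comp _ _ seq0 D; apply: cvg_near_eq; apply: nearW => n /=.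
by rewrite /u invrK.
Qed.

(** Differentiability turns the partial derivatives into the derivative along x, so t -> ln p (t x)
    - t m x' has zero derivative and takes the same value at 0 and 1. *)
Lemma linear_segment (m : 'rV[R]_k) : (forall i x, s i x = m 0 i) ->
  forall x, lnp x = lnp 0 + (m *m x^T) 0 0.
Proof.
move=> sm x.
have Dx y : is_derive y x lnp ((m *m x^T) 0 0).
  apply: DeriveDef; first exact: diff_derivable.
  rewrite deriveE// [in X in 'd _ _ X](row_sum_delta x) linear_sum dotE.
  apply: eq_bigr => i _; rewrite linearZ/= -deriveE//.
  by have := sm i y; rewrite /s /partial => ->; rewrite /GRing.scale/= mulrC.
pose phi (t : R) := lnp (t *: x) - t * (m *m x^T) 0 0.
have Dphi (t : R) : is_derive t 1 phi 0.
  apply: cvg_is_derive.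
  have [+ E] := Dx (t *: x); rewrite /derivable => /cvg_ex[l Hl].
  have El : l = (m *m x^T) 0 0 by rewrite -E; apply/esym; exact: (cvg_lim _ Hl).
  rewrite -[X in _ --> X](subrr ((m *m x^T) 0 0)) -{1}El.
  apply: cvg_near_eq (cvgB Hl (cvg_cst ((m *m x^T) 0 0))); near=> h.
  have hn0 : h != 0 by near: h; exact: nbhs_dnbhs_neq.
  transitivity (h^-1 * (lnp (h *: x + t *: x) - lnp (t *: x)) - (m *m x^T) 0 0) => //.
  transitivity (h^-1 * (phi (h *: 1 + t) - phi t)) => //.
  rewrite /phi [h *: 1]mulr1 scalerDl; set a := lnp _; set b := lnp _.
  by field.
have := is_derive_0_is_cst 1 0 Dphi; rewrite /phi scale1r mul1r scale0r mul0r subr0.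
by move=> <-; rewrite subrK.
Unshelve. all: by end_near. Qed.

Lemma score_nonconstant : (0 < k)%N -> forall c, ~ forall x, gradient lnp x = c.
Proof.
move=> k0 m gm.
have sm i x : s i x = m 0 i by rewrite -(gm x) mxE.
have lE := linear_segment sm.
(* N exceeds 1 / p(0). The box of side N in the orthant where m x' is nonnegative has p >= p(0),
   hence mass at least p(0) N^k >= p(0) N > 1; the first inequality uses k > 0. *)
pose N : R := (Num.trunc (p 0)^-1).+1%:R.
have N1 : 1 <= N by rewrite ler1n.
pose a i : R := if 0 <= m 0 i then 0 else - N.
pose b i : R := a i + N.
have ab i : a i <= b i by rewrite lerDl (le_trans ler01).
have low x : box a b x -> p 0 <= p x.
  move=> Bx; rewrite -ler_ln ?posrE//; have := lE x; rewrite /lnp => ->.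
  rewrite lerDl dotE; apply: sumr_ge0 => i _; have := Bx i; rewrite /b /a.
  by case: ifPn => [m0 /andP[x0 _]|/=]; [exact: mulr_ge0|rewrite -ltNge; nra].
have := density_box_lower dens ab (ltW (ppos 0)) low.
have -> : \prod_i (b i - a i) = N ^+ k.
  by under eq_bigr do rewrite /b addrAC subrr add0r; rewrite prodr_const card_ord.
move=> /le_trans /(_ (probability_le1 Pi (measurable_box a b))).
rewrite lee_fin leNgt => /negP; apply.
have p0 := ppos 0.
rewrite -ltr_pdivrMl// mulr1.
apply: (@lt_le_trans _ _ N); first exact: truncnS_gt.
by rewrite -[k]prednK// exprS ler_peMr ?(le_trans ler01)// exprn_ege1.
Qed.

End score.

(** * The decay rate *)

Lemma bilinE {R : realType} {k : nat} (L : 'M[R]_k) (c b : 'rV[R]_k) :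
  (c *m L *m b^T) 0 0 = \sum_i \sum_j L i j * (c 0 i * b 0 j).
Proof.
rewrite mxE exchange_big/=; apply: eq_bigr => j _; rewrite !mxE big_distrl/=.
by apply: eq_bigr => i _; ring.
Qed.

Lemma frobeniusZB {R : realType} {k : nat} (a b : R) (L M B : 'M[R]_k) :
  frobenius (a *: L - b *: M) B = a * frobenius L B - b * frobenius M B.
Proof.
rewrite /frobenius [a * _]big_distrr [b * _]big_distrr/= -sumrB; apply: eq_bigr => i _.
rewrite [a * _]big_distrr [b * _]big_distrr/= -sumrB.
by apply: eq_bigr => j _; rewrite !mxE; ring.
Qed.

Lemma covariance_mean {d} {T : measurableType d} {R : realType} (P : probability T R)
    (U V : T -> R) : square_integrable P U -> square_integrable P V ->
  fine (covariance P U V) =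
  \int[P]_w (U w * V w) - (\int[P]_w U w) * (\int[P]_w V w).
Proof.
move=> sU sV; rewrite fine_covarianceE.
set a := \int[P]_w U w; set b := \int[P]_w V w.
have -> : (fun w => (U w - a) * (V w - b)) =
    (fun w => U w * V w - (b * U w + a * V w - a * b)).
  by apply/funext => w; ring.
have IU := square_integrable_integrable sU; have IV := square_integrable_integrable sV.
have Iab : P.-integrable setT (EFin \o cst (a * b)).
  exact: finite_measure_integrable_cst.
rewrite RintegralB//; [|exact: square_integrable_mul|].
  rewrite RintegralB//; last by apply: integrableRD; exact: integrableRZ.
  rewrite RintegralD//; [|exact: integrableRZ|exact: integrableRZ].
  have E : \int[P]_x (a * b) = a * b by exact: Rintegral_prob_cst.
  by rewrite E !RintegralZl// -/a -/b; ring.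
by apply: integrableRB => //; apply: integrableRD; exact: integrableRZ.
Qed.

(** * Derivative of the autocorrelation at lag 0 *)

Section decay.
Context {R : realType} {k : nat} {d : measure_display} {Om : measurableType d}.
Variables (P : probability Om R) (Pi : probability 'rV[R]_k R) (X : R -> Om -> 'rV[R]_k).
Variables (p : 'rV[R]_k -> R) (L : 'M[R]_k).
Hypothesis dens : has_lebesgue_density Pi p.
Hypothesis lip : lipschitz_score p.
Hypothesis mom : second_moments Pi.
Hypothesis Lspd : spd L.
Hypothesis diff : stationary_diffusion P X Pi (langevin_generator Pi p L).

Let score := gradient (fun y => ln (p y)).
Let s i := partial i (fun y => ln (p y)).
Let fish := frobenius L (variance_mx Pi score).
Let A : 'M[R]_k := (k%:R * fish^-1) *: L.

Lemma second_moments_square_integrable l : square_integrable Pi (fun x : 'rV[R]_k => x 0 l).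
Proof.
split; first exact: measurable_coord.
have := Lfun2_integrable_sqr (mom l).
by move=> H; exact: H.
Qed.

Lemma langevin_generatorE f g H : jet f g H ->
  langevin_generator Pi p L f = diffusion_op A s g H.
Proof.
move=> J; apply/funext => x; rewrite /langevin_generator -/score -/fish.
have [Lsym _] := Lspd.
(* Symmetry reconciles the index order of [frobenius] with that of [bilinE]. *)
have Ls i j : L j i = L i j by rewrite -{1}Lsym mxE.
rewrite bilinE /frobenius /diffusion_op -big_split big_distrr/=; apply: eq_bigr => i _.
rewrite -big_split big_distrr/=; apply: eq_bigr => j _.
rewrite !mxE (jet_partial2 _ _ J) (jet_partial _ J) Ls -/(s i); ring.
Qed.

Lemma autocorrelation_derivative (v : 'rV[R]_k) : v != 0 ->
  right_quotient0 (autocorrelation P X (fun x => (v *m x^T) 0 0)) t @[t --> 0^'+] -->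
  - (k%:R * (v *m L *m v^T) 0 0 /
     (fish * (v *m variance_mx Pi id *m v^T) 0 0)).
Proof.
move=> v0; set f := fun x : 'rV[R]_k => _; set g := (_ *m variance_mx _ _ *m _) 0 0.
have [_ [lawX [Q [_ [mX markov] gen]]]] := diff.
have [S S0 Sg] := score_growth lip.
have D : t^-1 * (lag_moment P X f f t - lag_moment P X f f 0) @[t --> 0^'+] -->
    - \sum_i \sum_j A i j * (v 0 i * v 0 j).
  apply: (linear_lag_derivative mX lawX markov gen S0 Sg) => //.
  - exact: continuous_score.
  - exact: (measurable_score dens lip).
  - exact: second_moments_square_integrable.
  - exact: langevin_generatorE.
have sf : square_integrable Pi f by apply: square_integrable_linear_form;
  exact: second_moments_square_integrable.
have [mf _] := sf.
set mu := \int[Pi]_x f x.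
have gE : g = \int[Pi]_x (f x * f x) - mu * mu.
  rewrite /g (variance_quad second_moments_square_integrable) -covariance_mean//
    fine_covarianceE.
  have muE : mu = (v *m (mean_vec Pi id)^T) 0 0.
    rewrite /mu /f dotE; under eq_Rintegral do rewrite dotE.
    have Ix i := square_integrable_integrable (second_moments_square_integrable i).
    rewrite Rintegral_sum => [|i]; last exact: integrableRZ.
    by apply: eq_bigr => i _; rewrite RintegralZl// mxE.
  apply: eq_Rintegral => x _; rewrite -/mu muE /f !dotE -sumrB expr2.
  by congr (_ * _); apply: eq_bigr => i _; rewrite !mxE mulrBr.
have g0 : 0 < g.
  have [ppos _ _] := lip.
  by have [_] := spd_variance_id dens ppos second_moments_square_integrable; apply.
have Xs t : 0 <= t -> square_integrable P (f \o X t) by move=> t0;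
  exact: (square_integrable_law mX lawX t0 sf).
have Xm t : 0 <= t -> \int[P]_w (f \o X t) w = mu.
  by move=> t0; exact: (Rintegral_law mX lawX t0 mf).
have Xv t : 0 <= t -> fine 'V_P[f \o X t] = g.
  move=> t0; rewrite covariance_mean ?Xm//; try exact: Xs.
  rewrite gE; congr (_ - _).
  apply: (Rintegral_law (f := fun x => f x * f x) mX lawX t0).
  exact: measurable_funM.
(* By stationarity both means are mu and both variances g, so the autocorrelation is affine in the
   lag moment with coefficients free of t. *)
have corE t : 0 <= t -> autocorrelation P X f t = (lag_moment P X f f t - mu * mu) / g.
  move=> t0; rewrite /autocorrelation /correlation !Xv// -expr2 sqr_sqrtr ?ltW//.
  by rewrite covariance_mean ?Xm//; exact: Xs.
have H : t^-1 * (lag_moment P X f f t - lag_moment P X f f 0) * g^-1 @[t --> 0^'+] -->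
    - (\sum_i \sum_j A i j * (v 0 i * v 0 j)) * g^-1.
  by apply: cvgM => //; exact: cvg_cst.
move: H.
have -> : - (\sum_i \sum_j A i j * (v 0 i * v 0 j)) * g^-1 =
   - (k%:R * (v *m L *m v^T) 0 0 / (fish * g)).
  rewrite mulNr; congr (- _); rewrite invfM mulrA; congr (_ * _).
  rewrite bilinE [RHS]mulrAC big_distrr/=; apply: eq_bigr => i _.
  by rewrite big_distrr/=; apply: eq_bigr => j _; rewrite mxE; ring.
apply: cvg_near_eq; near=> t.
have t0 : 0 <= t by apply: ltW; near: t; exact: nbhs_right_gt.
by rewrite /right_quotient0 !corE//=; ring.
Unshelve. all: by end_near. Qed.

Lemma fisher_gt0 : (0 < k)%N -> 0 < fish.
Proof.
move=> k0; have [ppos _ _] := lip; have [S S0 Sg] := score_growth lip.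
have E i : (fun x => score x 0 i) = s i by apply/funext => x; rewrite mxE.
apply: (frobenius_variance_gt0 dens ppos) => //.
- move=> i; rewrite E; apply: (square_integrable_growth Sg) => [j|];
  last exact: second_moments_square_integrable.
  exact: (measurable_score dens lip).
- by move=> i; rewrite E; exact: continuous_score.
- exact: (score_nonconstant dens lip).
Qed.

End decay.

(** * Optimality of the covariance matrix *)

Unset Implicit Arguments.
Set Strict Implicit.

Theorem theorem2p10 (R : realType) (k : nat)
    (p : 'rV[R]_k -> R) (Pi : probability 'rV[R]_k R)
    (d : 'M[R]_k -> measure_display)
    (Om : forall L : 'M[R]_k, measurableType (d L))
    (P : forall L : 'M[R]_k, probability (Om L) R)
    (X : forall L : 'M[R]_k, R -> Om L -> 'rV[R]_k) :
  (0 < k)%N ->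
  has_lebesgue_density Pi p ->
  lipschitz_score p ->
  second_moments Pi ->
  (forall L : 'M[R]_k, spd L ->
     stationary_diffusion (P L) (X L) Pi (langevin_generator Pi p L)) ->
  let Gamma := variance_mx Pi id in
  [/\ spd Gamma,
      forall L : 'M[R]_k, spd L -> forall f, linear_observables f ->
        right_derivable0 (autocorrelation (P L) (X L) f) &
      forall L : 'M[R]_k, spd L ->
        worst_decay_rate (P L) (X L) <= worst_decay_rate (P Gamma) (X Gamma)].
Proof.
move=> k0 dens lip mom diff Gamma.
have [ppos _ _] := lip.
have Gspd : spd Gamma := spd_variance_id dens ppos (second_moments_square_integrable mom).
pose F L := frobenius L (variance_mx Pi (gradient (fun y => ln (p y)))).
have F0 L : spd L -> 0 < F L by move=> /fisher_gt0; apply.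
pose q (L : 'M[R]_k) (v : 'rV[R]_k) := (v *m L *m v^T) 0 0.
have q0 L v : spd L -> v != 0 -> 0 < q L v by move=> [_ H]; exact: H.
have deriv L v (Ls : spd L) (v0 : v != 0) :=
  autocorrelation_derivative dens lip mom Ls (diff L Ls) v0.
have rate L v : spd L -> v != 0 ->
    `|right_derivative0 (autocorrelation (P L) (X L) (fun x => (v *m x^T) 0 0))| =
    k%:R * q L v / (F L * q Gamma v).
  move=> Ls v0; rewrite /right_derivative0 (cvg_lim _ (deriv L v Ls v0))//.
  rewrite normrN ger0_norm// divr_ge0 ?mulr_ge0 ?ler0n// ltW//; do ?exact: q0.
  exact: F0.
split => //.
  by move=> L Ls f [v v0 ->]; apply/cvg_ex; eexists; exact: deriv.
move=> L Ls.
have kR : (0 : R) < k%:R by rewrite ltr0n.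
(* A nonzero vector makes the family of observables nonempty, so that for Gamma the infimum is that
   of a singleton and not the default value on the empty set. *)
have [v1 v10] : exists v : 'rV[R]_k, v != 0.
  exists (const_mx 1); apply/eqP => /rowP /(_ (Ordinal k0)) /eqP.
  by rewrite !mxE oner_eq0.
have rateG : worst_decay_rate (P Gamma) (X Gamma) = k%:R / F Gamma.
  rewrite /worst_decay_rate (_ : [set _ | _ in _] = [set k%:R / F Gamma]) ?inf1//.
  have E v : v != 0 -> k%:R * q Gamma v / (F Gamma * q Gamma v) = k%:R / F Gamma.
    move=> v0; have g0 := q0 _ _ Gspd v0; have f0 := F0 _ Gspd.
    by field; rewrite !gt_eqF.
  apply/seteqP; split => [_ [_ [v v0 ->] <-]|_ ->] /=; first by rewrite rate// E.
  exists (fun x => (v1 *m x^T) 0 0); first by exists v1.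
  by rewrite rate// E.
rewrite rateG.
set lam := worst_decay_rate _ _.
have lam_le v : v != 0 -> lam <= k%:R * q L v / (F L * q Gamma v).
  move=> v0; apply: ge_inf.
    by exists 0 => _ [f _ <-].
  exists (fun x => (v *m x^T) 0 0); first by exists v.
  exact: rate.
have FL := F0 _ Ls; have FG := F0 _ Gspd.
(* Clearing the positive denominator in [lam_le] gives the nonnegativity of the quadratic form of M.
   Only the lower-bound property of the infimum enters; no minimising v has to be found. *)
pose M : 'M[R]_k := k%:R *: L - (lam * F L) *: Gamma.
have M0 v : 0 <= q M v.
  have [->|v0] := eqVneq v 0; first by rewrite /q !mul0mx mxE.
  have -> : q M v = k%:R * q L v - lam * F L * q Gamma v.
    by rewrite /q /M mulmxBr mulmxBl -!scalemxAr -!scalemxAl !mxE.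
  have g0 := q0 _ _ Gspd v0.
  have := lam_le v v0; rewrite ler_pdivlMr ?mulr_gt0// subr_ge0; apply: le_trans.
  by rewrite mulrA.
have : 0 <= F M.
  apply: frobenius_variance_ge0 => // i.
  have [S S0 Sg] := score_growth lip.
  have -> : (fun x => gradient (fun y => ln (p y)) x 0 i) = partial i (fun y => ln (p y)).
    by apply/funext => x; rewrite mxE.
  apply: (square_integrable_growth Sg) => [j|];
    last exact: second_moments_square_integrable.
  exact: (measurable_score dens lip).
have -> : F M = k%:R * F L - lam * F L * F Gamma.
  exact: frobeniusZB.
have -> : k%:R * F L - lam * F L * F Gamma = F L * (k%:R - lam * F Gamma) by ring.
by rewrite pmulr_rge0// subr_ge0 ler_pdivlMr.
Qed.
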